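(* Let $d\ge 2$. Let $\widehat X$ be a stationary Poisson hyperplane process in $\mathbb{R}^d$ (with locally finite, not identically zero intensity measure) with spherical directional distribution $\varphi$, and let $X$ be the tessellation of $\mathbb{R}^d$ induced by $\widehat X$. Suppose that the support of $\varphi$ is the whole unit sphere $\mathbb{S}^{d-1}$ and that $\varphi(\mathbb{S}^{d-1}\cap L)=0$ for every $(d-1)$-dimensional linear subspace $L$ of $\mathbb{R}^d$ (that is, $\varphi$ assigns measure zero to each great subsphere of $\mathbb{S}^{d-1}$). Then, with probability one, each combinatorial type of a simple $d$-polytope appears with positive density in $X$; that is, almost surely, simultaneously for every combinatorial type $A$ of a simple $d$-polytope in $\mathbb{R}^d$, $$\liminf_{n\to\infty}\frac{1}{\lambda_d(B_n)}\sum_{P\in X,\;P\subset B_n}\mathbf{1}_A(P)>0 .$$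
   Context: Notation: $\langle\cdot,\cdot\rangle$ is the standard scalar product on $\mathbb{R}^d$, $\lambda_d$ is Lebesgue measure on $\mathbb{R}^d$, $B_n$ ($n\in\mathbb{N}$) is the closed ball in $\mathbb{R}^d$ with center at the origin and radius $n$, $\mathbb{S}^{d-1}$ is the unit sphere, and $\mathbf{1}_A$ is the indicator function of $A$. $\mathcal{H}$ is the space of (affine) hyperplanes in $\mathbb{R}^d$ with its usual topology and Borel $\sigma$-algebra $\mathcal{B}(\mathcal{H})$. For $u\in\mathbb{S}^{d-1}$ and $\tau\in\mathbb{R}$, $H(u,\tau)=\{x\in\mathbb{R}^d:\langle x,u\rangle=\tau\}$. Poisson hyperplane process: A stationary Poisson hyperplane process $\widehat X$ is a Poisson point process in $\mathcal{H}$, defined on some probability space $(\Omega,\mathcal{A},\mathbb{P})$, whose distribution is invariant under translations of $\mathbb{R}^d$. Its intensity measure is $\widehat\Theta(A)=\mathbb{E}\,\widehat X(A)$ for $A\in\mathcal{B}(\mathcal{H})$, assumed to be locally finite and not identically zero. In particular $\mathbb{P}(\widehat X(A)=k)=e^{-\widehat\Theta(A)}\widehat\Theta(A)^k/k!$ for $k\in\mathbb{N}_0$ and every $A\in\mathcal{B}(\mathcal{H})$ with $\widehat\Theta(A)<\infty$. By stationarity, $$\widehat\Theta(A)=\widehat\gamma\int_{\mathbb{S}^{d-1}}\int_{-\infty}^{\infty}\mathbf{1}_A(H(u,\tau))\,\mathrm{d}\tau\,\varphi(\mathrm{d}u),\qquad A\in\mathcal{B}(\mathcal{H}),$$ with a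 number $\widehat\gamma>0$ (the intensity) and a finite, even Borel measure $\varphi$ on $\mathbb{S}^{d-1}$, called the spherical directional distribution of $\widehat X$. The process is simple, and a realization of $\widehat X$ is identified with its support, a locally finite set of hyperplanes. Induced tessellation: Given a realization of $\widehat X$ (a set of hyperplanes), the induced tessellation $X$ is the set of closures of the connected components of $\mathbb{R}^d\setminus\bigcup_{H\in\widehat X}H$. Under the assumptions on $\varphi$ in the claim, almost surely these closures are convex polytopes, which cover $\mathbb{R}^d$ and have pairwise no common interior points. Polytopes: A $d$-polytope is a $d$-dimensional convex polytope. It is simple if each of its vertices is contained in precisely $d$ facets. The combinatorial type of a polytope $P$ in $\mathbb{R}^d$ is the set of all polytopes in $\mathbb{R}^d$ that are combinatorially isomorphic to $P$ (have isomorphic face lattice). Density: For a tessellation $T$ of $\mathbb{R}^d$ (viewed as a set of polytopes) and a translation invariant set $A$ of polytopes in $\mathbb{R}^d$, one says that $A$ appears in $T$ with density $\delta$ if $\liminf_{n\to\infty}\frac{1}{\lambda_d(B_n)}\sum_{P\in T,\,P\subset B_n}\mathbf{1}_A(P)=\delta$; it appears with positive density if this $\delta$ is $>0$. *)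

(* Defs.v *)
From HB Require Import structures.
From mathcomp Require Import all_boot all_order all_algebra.
From mathcomp Require Import all_classical all_reals all_analysis.
From mathcomp Require Import measurable_realfun.
Set Implicit Arguments.
Unset Strict Implicit.
Unset Printing Implicit Defensive.
Import Order.TTheory GRing.Theory Num.Theory.
Import numFieldNormedType.Exports.
Local Open Scope classical_set_scope.
Local Open Scope ring_scope.
Local Open Scope ereal_scope.

Section Euclidean.
Variables (R : realType) (d : nat).
Local Notation V := 'rV[R]_d.

Definition dot (x y : V) : R := (\sum_(i < d) x ord0 i * y ord0 i)%R.

(* The library's norm on row vectors is the sup norm; it induces the usual
   topology, but spheres and balls have to be taken for the Euclidean norm. *)
Definition enorm (x : V) : R := Num.sqrt (dot x x).

Definition sphere : set V := [set u | enorm u = 1%R].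

Definition eball (r : R) : set V := [set x | (enorm x <= r)%R].

Definition borelV := g_sigma_algebraType (@open V).

Definition box (a b : V) : set V :=
  [set x | forall i, (a ord0 i <= x ord0 i <= b ord0 i)%R].

Definition box_volume (a b : V) : R := (\prod_(i < d) (b ord0 i - a ord0 i))%R.

(* d-dimensional Lebesgue measure as the Lebesgue outer measure: infimum of the
   total volumes of countable covers by boxes. *)
Definition lebesgueV (A : set V) : \bar R :=
  ereal_inf [set \sum_(k <oo) (box_volume (ab k).1 (ab k).2)%:E |
    ab in [set ab : nat -> V * V |
      (forall k i, ((ab k).1 ord0 i <= (ab k).2 ord0 i)%R) /\
      A `<=` \bigcup_k box (ab k).1 (ab k).2]].

End Euclidean.

Section Hyperplanes.
Variables (R : realType) (d : nat).
Local Notation V := 'rV[R]_d.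

Definition hyperplane (u : V) (tau : R) : set V := [set x | dot x u = tau].

Definition hyperplanes : set (set V) :=
  [set H | exists u tau, sphere u /\ H = hyperplane u tau].

(* The usual topology: the finest one making (u, tau) |-> H(u, tau) continuous
   on S^(d-1) x R, i.e. the quotient of S^(d-1) x R by (u, tau) ~ (-u, -tau). *)
Definition hopen (U : set (set V)) : Prop :=
  U `<=` hyperplanes /\
  exists O : set (V * R)%type, open O /\
    forall u tau, sphere u -> (U (hyperplane u tau) <-> O (u, tau)).

Definition hborel : set (set (set V)) := <<s hyperplanes, hopen >>.

Definition locally_finite_set (S : set (set V)) : Prop :=
  forall H, hyperplanes H ->
    exists U, [/\ hopen U, U H & finite_set (S `&` U)].

Definition locally_finite_measure (Theta : set (set V) -> \bar R) : Prop :=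
  forall H, hyperplanes H ->
    exists U, [/\ hopen U, U H & Theta U < +oo].

Definition translate (t : V) (A : set V) : set V := [set (x + t)%R | x in A].

Definition npoints (S A : set (set V)) : \bar R := counting (S `&` A).

(* The sigma-algebra on the space of configurations, generated by the
   evaluations S |-> S(A). *)
Definition config_events : set (set (set (set V))) :=
  <<s [set E | exists (A : set (set V)) (B : set (\bar R)),
    [/\ hborel A, measurable B & E = [set S | B (npoints S A)]]] >>.

End Hyperplanes.

Section PoissonProcess.
Context {disp : measure_display} {Omega : measurableType disp} {R : realType}.
Variables (d : nat) (P : probability Omega R).
Local Notation V := 'rV[R]_d.
Implicit Type X : Omega -> set (set V).

(* A simple point process, each realization being identified with its support,
   a locally finite set of hyperplanes. *)
Definition hyperplane_process X : Prop :=
  [/\ forall w, X w `<=` @hyperplanes R d,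
      forall w, locally_finite_set (X w) &
      forall A, @hborel R d A ->
        measurable_fun [set: Omega] (fun w => npoints (X w) A)].

Definition intensity_measure X (A : set (set V)) : \bar R :=
  \int[P]_w npoints (X w) A.

Definition poisson_counts X : Prop :=
  forall A, @hborel R d A -> intensity_measure X A < +oo ->
  forall k : nat,
    P [set w | npoints (X w) A = k%:R%:E] =
    (expR (- fine (intensity_measure X A)) *
      fine (intensity_measure X A) ^+ k / k`!%:R)%R%:E.

Definition independent_on_disjoint X : Prop :=
  forall (m : nat) (A : 'I_m -> set (set V)) (B : 'I_m -> set (\bar R)),
    (forall i, @hborel R d (A i)) -> trivIset [set: 'I_m] A ->
    (forall i, measurable (B i)) ->
    P [set w | forall i, B i (npoints (X w) (A i))] =
    \prod_(i < m) P [set w | B i (npoints (X w) (A i))].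

Definition stationary X : Prop :=
  forall (t : V) (E : set (set (set V))), @config_events R d E ->
    P [set w | E (X w)] = P [set w | E (translate t @` X w)].

Definition stationary_poisson_hyperplane_process X : Prop :=
  [/\ hyperplane_process X,
      poisson_counts X /\ independent_on_disjoint X,
      stationary X,
      locally_finite_measure (intensity_measure X) &
      exists2 A, @hborel R d A & intensity_measure X A != 0].

(* A Borel measure on the sphere is given as a Borel measure on R^d that
   vanishes off the sphere. *)
Definition spherical_directional_distribution X
    (phi : {finite_measure set (borelV R d) -> \bar R}) : Prop :=
  [/\ phi (~` @sphere R d) = 0,
      forall B : set (borelV R d), measurable B ->
        phi [set (- u)%R | u in (B : set V)] = phi B &
      exists2 gamma : R, (0 < gamma)%R &
        forall A, @hborel R d A ->
          intensity_measure X A =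
          gamma%:E * \int[phi]_(u in @sphere R d)
            \int[@lebesgue_measure R]_tau (\1_A (hyperplane u tau) : R)%:E].

End PoissonProcess.

Definition measure_support (R : realType) (d : nat)
    (phi : set (borelV R d) -> \bar R) : set 'rV[R]_d :=
  [set u | forall U : set 'rV[R]_d, open U -> U u -> 0 < phi U].

Section Polytopes.
Variables (R : realType) (d : nat).
Local Notation V := 'rV[R]_d.

Definition induced_tessellation (S : set (set V)) : set (set V) :=
  let D : set V := ~` \bigcup_(H in S) H in
  [set closure (connected_component D x) | x in D].

Definition convex_hull (m : nat) (p : 'I_m -> V) : set V :=
  [set x | exists a : 'I_m -> R,
    [/\ forall i, (0 <= a i)%R, (\sum_(i < m) a i = 1)%R &
        x = (\sum_(i < m) a i *: p i)%R]].

Definition polytope (Q : set V) : Prop :=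
  exists (m : nat) (p : 'I_m -> V), Q = convex_hull p.

Definition flat (x : V) (L : {vspace V}) : set V := [set (x + v)%R | v in [set` L]].

Definition affine_hull (F : set V) : set V :=
  \bigcap_(A in [set A | (exists x L, A = flat x L) /\ F `<=` A]) A.

Definition has_dim (F : set V) (k : nat) : Prop :=
  exists x L, affine_hull F = flat x L /\ \dim L = k.

(* Taking c = 0 yields the improper faces Q and set0. *)
Definition face (Q F : set V) : Prop :=
  exists (c : V) (b : R), (forall x, Q x -> (dot c x <= b)%R) /\
    F = Q `&` [set x | dot c x = b].

Definition facet (Q F : set V) : Prop := face Q F /\ has_dim F d.-1.

Definition vertex (Q : set V) (v : V) : Prop := face Q [set v].

Definition simple_dpolytope (Q : set V) : Prop :=
  [/\ polytope Q, has_dim Q d &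
      forall v, vertex Q v -> ([set F | facet Q F /\ F v] #= `I_d)%card].

Definition combinatorially_isomorphic (Q Q' : set V) : Prop :=
  exists f : set V -> set V, set_bij (face Q) (face Q') f /\
    forall F G, face Q F -> face Q G -> (F `<=` G <-> f F `<=` f G).

Definition combinatorial_type (Q : set V) : set (set V) :=
  [set Q' | polytope Q' /\ combinatorially_isomorphic Q Q'].

Definition lower_density (T A : set (set V)) : \bar R :=
  limn_einf (fun n : nat =>
    (\esum_(Q in [set Q | T Q /\ Q `<=` eball n%:R]) (\1_A Q : R)%:E) /
    lebesgueV (@eball R d n%:R)).

Definition appears_with_positive_density (T A : set (set V)) : Prop :=
  0 < lower_density T A.

End Polytopes.

(* Main.v *)
Require Import Defs.
From HB Require Import structures.
From mathcomp Require Import all_boot all_order all_algebra.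
From mathcomp Require Import all_classical all_reals all_analysis.
From mathcomp Require Import measurable_realfun.
From mathcomp Require Import finmap ring lra zify.
Import Order.TTheory GRing.Theory Num.Theory.
Import numFieldNormedType.Exports.
Set Implicit Arguments.
Unset Strict Implicit.
Unset Printing Implicit Defensive.
Local Open Scope classical_set_scope.
Local Open Scope ring_scope.

(** The facet normals of a simple polytope Q are linearly independent at each
    vertex, so the family of sets of inequalities that are simultaneously tight
    at some point of Q, which determines the face lattice, does not change when
    the facet hyperplanes are moved slightly. Hence, for a ball B(z, r) large
    enough, a cell of the type of Q lies in B(z, r) as soon as each of certain
    small disjoint neighbourhoods (translated by z) of the facet hyperplanes
    contains exactly one hyperplane of the process and no other hyperplane of
    the process meets B(z, r). By stationarity this pattern has a probability
    p > 0 that does not depend on z.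

    No ergodic theorem is needed. Take z in a lattice cube with N^d points. The
    covariance of the events at z and z' is at most 4 times the intensity of the
    hyperplanes that meet both balls, and a hyperplane meets at most d N^(d-1)
    of the balls, so the average number of patterns has variance O(1/N). By
    Chebyshev's inequality and the Borel-Cantelli lemma along N = 2^k, almost
    surely at least half of the expected number p N^d of patterns eventually
    occur, and monotonicity interpolates between powers of 2. Restricting the
    neighbourhoods to rational centres and radii leaves countably many events. *)

(** * Polytopes as intersections of halfspaces *)

(** Simplicity gives the independence: a vertex lies on only [d] facets, so the normals tight there,
    which span the space, are independent, and a point can follow any small change of the
    corresponding hyperplanes. The probability [p] is positive because the neighbourhoods and the
    remaining hyperplanes that hit the ball form disjoint sets, whose counts are independent Poisson
    variables; each neighbourhood has positive intensity since [phi] charges every nonempty open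
    part of the sphere. Only the patterns have to be measurable events. The tessellation enters
    through a deterministic statement: in every realization, a pattern at [z] forces a cell near
    [z]. The lattice spacing is twice the radius of the balls, so patterns at different lattice
    points force different cells. *)

Section Dot.
Variables (R : realType) (d : nat).
Implicit Types x y z : 'rV[R]_d.

Lemma dotC x y : dot x y = dot y x.
Proof. by apply: eq_bigr => i _; rewrite mulrC. Qed.

Lemma dotDl x y z : dot (x + y) z = dot x z + dot y z.
Proof. by rewrite -big_split; apply: eq_bigr => i _; rewrite !mxE mulrDl. Qed.

Lemma dotZl a x z : dot (a *: x) z = a * dot x z.
Proof. by rewrite mulr_sumr; apply: eq_bigr => i _; rewrite !mxE mulrA. Qed.

Lemma dotNl x z : dot (- x) z = - dot x z.
Proof. by rewrite -scaleN1r dotZl mulN1r. Qed.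

Lemma dotBl x y z : dot (x - y) z = dot x z - dot y z.
Proof. by rewrite dotDl dotNl. Qed.

Lemma dot0l z : dot 0 z = 0.
Proof. by rewrite -(scale0r 0) dotZl mul0r. Qed.

Lemma dotDr x y z : dot z (x + y) = dot z x + dot z y.
Proof. by rewrite dotC dotDl !(dotC z). Qed.

Lemma dotZr a x z : dot z (a *: x) = a * dot z x.
Proof. by rewrite dotC dotZl (dotC z). Qed.

Lemma dotNr x z : dot z (- x) = - dot z x.
Proof. by rewrite dotC dotNl (dotC z). Qed.

Lemma dotBr x y z : dot z (x - y) = dot z x - dot z y.
Proof. by rewrite dotDr dotNr. Qed.

Lemma dot0r z : dot z 0 = 0.
Proof. by rewrite dotC dot0l. Qed.

Lemma dot_suml (I : Type) (r : seq I) (P : pred I) (F : I -> 'rV[R]_d) z :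
  dot (\sum_(i <- r | P i) F i) z = \sum_(i <- r | P i) dot (F i) z.
Proof.
elim/big_rec2: _ => [|i y x _ <-]; first by rewrite dot0l.
by rewrite dotDl.
Qed.

Lemma dot_sumr (I : Type) (r : seq I) (P : pred I) (F : I -> 'rV[R]_d) z :
  dot z (\sum_(i <- r | P i) F i) = \sum_(i <- r | P i) dot z (F i).
Proof. by rewrite dotC dot_suml; apply: eq_bigr => i _; rewrite dotC. Qed.

Lemma dot_ge0 x : 0 <= dot x x.
Proof. by apply: sumr_ge0 => i _; rewrite -expr2 sqr_ge0. Qed.

Lemma dot_eq0 x : (dot x x == 0) = (x == 0).
Proof.
apply/idP/idP => [|/eqP ->]; last by rewrite dot0l.
rewrite psumr_eq0 => [|i _]; last by rewrite -expr2 sqr_ge0.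
move=> /allP h; apply/eqP/rowP => i; rewrite mxE.
by have := h i (mem_index_enum i); rewrite -expr2 sqrf_eq0 => /eqP.
Qed.

Lemma sphereE x : sphere x <-> dot x x = 1.
Proof.
rewrite /sphere/= /enorm; split=> [h|->]; last by rewrite sqrtr1.
by rewrite -[LHS]sqr_sqrtr ?dot_ge0// h expr1n.
Qed.

Lemma coord_norm x i : `|x ord0 i| <= `|x|.
Proof.
rewrite [leRHS]/Num.norm/= mx_normrE.
exact: (le_bigmax _ (fun ij : 'I_1 * 'I_d => `|x ij.1 ij.2|) (ord0, i)).
Qed.

Lemma norm_le_coord x r : 0 <= r -> (forall i, `|x ord0 i| <= r) -> `|x| <= r.
Proof.
move=> r0 xr; rewrite [leLHS]/Num.norm/= mx_normrE; apply: bigmax_le => //.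
by move=> [i j] _ /=; rewrite ord1.
Qed.

(** The factor [d] is the price for using the sup norm, in which the perturbation estimates below
    are carried out. *)
Lemma dot_norm x y : `|dot x y| <= d%:R * `|x| * `|y|.
Proof.
apply: (le_trans (ler_norm_sum _ _ _)).
apply: (@le_trans _ _ (\sum_(i < d) `|x| * `|y|)).
  by apply: ler_sum => i _; rewrite normrM; apply: ler_pM => //; exact: coord_norm.
by rewrite sumr_const card_ord -mulrA mulr_natl.
Qed.

(** Cauchy-Schwarz against a unit vector: the component of [x] orthogonal to [u] has nonnegative
    squared length. *)
Lemma dot_unit_sqr x u : sphere u -> (dot x u) ^+ 2 <= dot x x.
Proof.
move=> /sphereE u1.
have := dot_ge0 (x - dot x u *: u).
rewrite dotBl !dotBr !dotZl !dotZr u1 (dotC u) expr2; lra.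
Qed.

Lemma norm_enorm x : `|x| <= enorm x.
Proof.
apply: norm_le_coord => [|j]; first exact: sqrtr_ge0.
rewrite -sqrtr_sqr ler_sqrt ?dot_ge0//.
by rewrite /dot (bigD1 j)//= -expr2 lerDl sumr_ge0// => k _; rewrite -expr2 sqr_ge0.
Qed.

Lemma enorm_norm x : enorm x <= d%:R * `|x|.
Proof.
rewrite -(@ger0_norm _ (d%:R * `|x|)) ?mulr_ge0// -sqrtr_sqr ler_sqrt ?sqr_ge0//.
apply: (le_trans (ler_norm _)); apply: (le_trans (dot_norm _ _)).
rewrite exprMn -mulrA -expr2 ler_wpM2r ?sqr_ge0//.
by case: (d) => [|n]; rewrite ?expr0n//= ler_eXnr// ler1n.
Qed.

Lemma continuous_dot u : continuous (fun x : 'rV[R]_d => dot x u).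
Proof.
apply: (@continuous_big _ _ _ _ _ _ _ _ (fun i (x : 'rV[R]_d) => x ord0 i * u ord0 i)).
- exact: add_continuous.
- move=> i _ x; apply: (@continuousM _ _ (fun x : 'rV[R]_d => x ord0 i) (cst (u ord0 i))).
    exact: coord_continuous.
  exact: cst_continuous.
Qed.

End Dot.

Section Cone.
Variables (R : realType) (n : nat).
Local Notation V := 'rV[R]_n.

(** Supplies the smallest admissible coefficient of an eliminated generator. The floor 0 encodes the
    sign condition and also covers the case of no lower bound. *)
Lemma seq_sup (cs : seq V) (f : V -> R) : exists2 t, 0 <= t /\
  (forall c, c \in cs -> f c <= t) & t = 0 \/ exists2 c, c \in cs & t = f c.
Proof.
elim: cs => [|c cs [t [t0 tc] te]]; first by exists 0; [split|left].
have [fct|tfc] := leP (f c) t.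
  exists t; last by case: te => [->|[e ecs ->]]; [left|right; exists e; rewrite // inE ecs orbT].
  by split => // e; rewrite inE => /orP[/eqP->|/tc].
exists (f c); last by right; exists c; rewrite ?mem_head.
split=> [|e]; first by rewrite (le_trans t0)// ltW.
by rewrite inE => /orP[/eqP->//|/tc et]; rewrite (le_trans et)// ltW.
Qed.

(* Each induction step is a Fourier-Motzkin elimination of the coefficient of
   one generator. *)
Lemma cone_halfspaces m (p : 'I_m -> V) : exists cs : seq V, forall x,
  (exists2 a : 'I_m -> R, forall i, 0 <= a i & x = \sum_i a i *: p i) <->
  (forall c, c \in cs -> dot x c <= 0).
Proof.
elim: m p => [|m IH] p.
  (* Without generators the cone is the origin, cut out by the coordinate vectors and their
     opposites. *)
  exists ([seq delta_mx ord0 i | i <- enum 'I_n] ++ [seq - delta_mx ord0 i | i <- enum 'I_n]).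
  have dd (x : V) i : dot x (delta_mx ord0 i) = x ord0 i.
    rewrite /dot (bigD1 i)//= mxE !eqxx mulr1 big1 ?addr0// => j ji.
    by rewrite mxE (negbTE ji) andbF mulr0.
  move=> x; split=> [[a _ ->] c _|h]; first by rewrite big_ord0 dot0l.
  exists (fun=> 0) => //; rewrite big_ord0; apply/rowP => i; rewrite [RHS]mxE.
  apply/eqP; rewrite eq_le -dd h ?mem_cat ?map_f ?mem_enum//=.
  rewrite -oppr_le0 -dotNr h// mem_cat; apply/orP; right.
    by apply/mapP; exists i => //; rewrite mem_enum.
  by rewrite -enumT mem_enum.
have [cs csP] := IH (fun i => p (lift ord0 i)).
set p0 := p ord0.
pose Neg := [seq c <- cs | dot p0 c <= 0].
pose Pos := [seq c <- cs | 0 < dot p0 c].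
(* In [dot x c <= t * dot p0 c], the members of [Pos] bound [t] from below and those of [Neg] bound
   it from above or, if [dot p0 c = 0], not at all. Each combination is orthogonal to [p0] and
   compares a lower with an upper bound; [Neg] itself remains because of [0 <= t]. *)
exists (Neg ++ [seq dot p0 e *: c - dot p0 c *: e | c <- Neg, e <- Pos]) => x.
have step : (exists2 a : 'I_m.+1 -> R, forall i, 0 <= a i & x = \sum_i a i *: p i) <->
    exists2 t, 0 <= t & forall c, c \in cs -> dot x c <= t * dot p0 c.
  split=> [[a a0 ->]|[t t0 ht]].
    exists (a ord0) => // c ccs; rewrite big_ord_recl dotDl dotZl gerDl.
    by apply: (proj1 (csP _)) ccs; exists (fun i => a (lift ord0 i)).
  have [|a a0 xE] := (csP (x - t *: p0)).2.
    by move=> c ccs; rewrite dotBl dotZl subr_le0 ht.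
  exists (fun i => if unlift ord0 i is Some j then a j else t) => [i|].
    by case: unliftP.
  rewrite big_ord_recl unlift_none -/p0; apply/eqP; rewrite addrC -subr_eq; apply/eqP.
  by rewrite xE; apply: eq_bigr => i _; rewrite liftK.
rewrite step; split=> [[t t0 ht] c|h].
  rewrite mem_cat => /orP[|/allpairsP[[c1 c2]/=[]]].
    rewrite mem_filter => /andP[pc ccs].
    by apply: (le_trans (ht _ ccs)); rewrite mulr_ge0_le0.
  rewrite !mem_filter => /andP[p1 c1cs] /andP[p2 c2cs] ->.
  rewrite dotBr !dotZr.
  have h1 := ht _ c1cs; have h2 := ht _ c2cs.
  have : dot p0 c2 * dot x c1 <= dot p0 c2 * (t * dot p0 c1) by rewrite ler_wpM2l// ltW.
  have : (- dot p0 c1) * dot x c2 <= (- dot p0 c1) * (t * dot p0 c2).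
    by rewrite ler_wpM2l// oppr_ge0.
  nra.
have [t [t0 tP] tE] := seq_sup Pos (fun c => dot x c / dot p0 c).
exists t => // c ccs; have [pc|pc] := leP (dot p0 c) 0; last first.
  by rewrite -ler_pdivrMr// tP// mem_filter pc.
have cN : c \in Neg by rewrite mem_filter pc.
case: tE => [->|[e]]; first by rewrite mul0r h// mem_cat cN.
rewrite mem_filter => /andP[pe ecs] ->.
have : dot x (dot p0 e *: c - dot p0 c *: e) <= 0.
  apply: h; rewrite mem_cat; apply/orP; right; apply/allpairsP; exists (c, e) => /=.
  by split; rewrite // mem_filter pe.
rewrite dotBr !dotZr subr_le0 mulrAC ler_pdivlMr//; lra.
Qed.

End Cone.

Section Poly.
Variables (R : realType) (d : nat).
Local Notation V := 'rV[R]_d.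

Definition hpoly m (u : 'I_m -> V) (tau : 'I_m -> R) : set V :=
  [set x | forall i, dot x (u i) <= tau i].

Lemma dot_row_mx (x y : V) (a b : R) :
  dot (row_mx x a%:M) (row_mx y b%:M) = dot x y + a * b.
Proof.
rewrite /dot big_split_ord/= big_ord1; congr (_ + _).
  by apply: eq_bigr => i _; rewrite !row_mxEl.
by rewrite !row_mxEr !mxE.
Qed.

(** Homogenisation: [x] lies in the hull of the [p i] exactly when [(x, 1)] lies in the cone
    generated by the [(p i, 1)]; the last coordinate of each cone inequality becomes the offset. *)
Lemma convex_hull_hpoly m (p : 'I_m -> V) :
  exists k (u : 'I_k -> V) (tau : 'I_k -> R), convex_hull p = hpoly u tau.
Proof.
have [cs csP] := cone_halfspaces (fun i => row_mx (p i) (1%:M : 'M[R]_1)).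
pose c (i : 'I_(size cs)) := nth 0 cs i.
exists (size cs), (fun i => lsubmx (c i)), (fun i => - (rsubmx (c i)) ord0 ord0).
have dotc (x : V) i : dot (row_mx x (1%:M : 'M[R]_1)) (c i) =
    dot x (lsubmx (c i)) + (rsubmx (c i)) ord0 ord0.
  rewrite -{1}(hsubmxK (c i)) [rsubmx (c i)]mx11_scalar dot_row_mx mul1r.
  by rewrite !mxE.
have sumE (a : 'I_m -> R) : \sum_i a i *: row_mx (p i) (1%:M : 'M[R]_1) =
    row_mx (\sum_i a i *: p i) (\sum_i a i)%:M.
  rewrite (raddf_sum (@scalar_mx R 1)) /= -[RHS]addr0.
  elim/big_rec3: _ => [|i x y z _ ->]; first by rewrite row_mx0 addr0.
  by rewrite !addr0 scale_row_mx add_row_mx scale_scalar_mx mulr1.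
apply/seteqP; split=> [x [a [a0 a1 xE]] i|x h].
  have := (csP (row_mx x 1%:M)).1.
  rewrite xE => /(_ _ _ (mem_nth 0 (ltn_ord i))).
  rewrite -/(c i) dotc -lerBrDr sub0r; apply.
  by exists a => //; rewrite sumE a1.
have [|a a0] := (csP (row_mx x 1%:M)).2.
  move=> e /(nthP 0)[i ilt <-]; have := h (Ordinal ilt).
  by rewrite -[cs`_i]/(c (Ordinal ilt)) dotc -lerBrDr sub0r.
rewrite sumE => /eq_row_mx[xE /matrixP/(_ ord0 ord0)]; rewrite !mxE/= !mulr1n => a1.
by exists a; split.
Qed.

End Poly.

Section Flats.
Variables (R : realType) (d : nat).
Local Notation V := 'rV[R]_d.

Lemma orthogonal_vspace (u : V) : u != 0 ->
  exists2 L : {vspace V}, \dim L = d.-1 & forall w, (w \in L) = (dot w u == 0).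
Proof.
move=> u0.
have lin : linear (fun w : V => dot w u : R^o).
  by move=> a x y; rewrite dotDl dotZl.
pose f : {linear V -> R^o} := HB.pack (fun w : V => dot w u : R^o)
  (GRing.isLinear.Build _ _ _ _ _ lin).
exists (lker (linfun f)) => [|w]; last by rewrite memv_ker lfunE.
have := limg_ker_dim (linfun f) fullv; rewrite capfv dimvf.
have -> : limg (linfun f) = fullv.
  apply/eqP; rewrite eqEdim subvf dimvf/= lt0n dimv_eq0.
  apply/negP => /eqP h; have := memv_img (linfun f) (memvf u).
  by rewrite h memv0 lfunE/= dot_eq0 (negbTE u0).
by rewrite !dimvf/= dim_matrix mul1r addn1 => /(congr1 predn).
Qed.

Lemma hyperplane_flat (u z : V) (L : {vspace V}) :
  (forall w, (w \in L) = (dot w u == 0)) ->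
  [set x | dot x u = dot z u] = flat z L.
Proof.
move=> hL; apply/seteqP; split=> [x/= xz|_ [v vL <-]] /=.
  by exists (x - z); [rewrite /= hL dotBl xz subrr|rewrite addrC subrK].
by move: vL; rewrite /= hL dotDl => /eqP ->; rewrite addr0.
Qed.

Lemma affine_hull_subset (F A : set V) :
  (exists x L, A = flat x L) -> F `<=` A -> affine_hull F `<=` A.
Proof. by move=> fA FA x; apply. Qed.

Lemma full_dim_not_subset (Q : set V) (u : V) (t : R) : has_dim Q d -> u != 0 ->
  ~ (Q `<=` [set x | dot x u = t]).
Proof.
move=> [x [L [hQ dL]]] u0 QH.
have [L' _ hL'] := orthogonal_vspace u0.
have uu : dot u u != 0 by rewrite dot_eq0.
pose z := (t / dot u u) *: u.
have zt : dot z u = t by rewrite dotZl divfK.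
have : [set x | dot x u = t] (z + u).
  apply: (@affine_hull_subset Q) => //.
    by exists z, L'; rewrite -(hyperplane_flat _ hL') zt.
  rewrite hQ; exists (z + u - x); last by rewrite addrC subrK.
  have -> : L = fullv by apply/eqP; rewrite eqEdim subvf dimvf/= dim_matrix mul1r dL.
  exact: memvf.
rewrite /= dotDl zt => /eqP; rewrite -subr_eq0 addrAC subrr add0r.
exact/negP.
Qed.

(** A flat that contains [z] and [z + t *: w] contains the whole line through them, so every flat
    around [F] contains all directions orthogonal to [u]. *)
Lemma affine_hull_relative_open (F : set V) (z u : V) (L : {vspace V}) :
  (forall w, (w \in L) = (dot w u == 0)) ->
  F `<=` [set x | dot x u = dot z u] -> F z ->
  (forall w, dot w u = 0 -> exists2 t, t != 0 & F (z + t *: w)) ->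
  affine_hull F = flat z L.
Proof.
move=> hL FH Fz zF; apply/seteqP; split.
  apply: affine_hull_subset; first by exists z, L.
  by rewrite -(hyperplane_flat _ hL).
move=> _ [w /= + <-]; rewrite hL => /eqP /zF[t t0 Ft] _ [[x [K ->]] FK].
have [a aK aE] := FK _ Fz; have [b bK bE] := FK _ Ft.
have twK : t *: w \in K.
  have -> : t *: w = b - a by apply: (addrI z); rewrite -bE -{1}aE -addrA [a + _]addrC subrK.
  exact: rpredB.
have wK : w \in K by rewrite -(scalerK t0 w) rpredZ.
by exists (a + w); [exact: rpredD|rewrite addrA aE].
Qed.

End Flats.

Section Barycenter.
Variables (R : realType) (d m : nat).
Local Notation V := 'rV[R]_d.
Variables (x : 'I_m.+1 -> V).

Definition barycenter : V := m.+1%:R^-1 *: \sum_i x i.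

Lemma dot_barycenter c : dot barycenter c = m.+1%:R^-1 * \sum_i dot (x i) c.
Proof. by rewrite dotZl dot_suml. Qed.

Lemma barycenter_eq c b : (forall i, dot (x i) c = b) -> dot barycenter c = b.
Proof.
move=> h; rewrite dot_barycenter (eq_bigr (fun=> b)) ?sumr_const ?card_ord//.
by rewrite -[b *+ _]mulr_natl mulKf.
Qed.

Lemma barycenter_le c b : (forall i, dot (x i) c <= b) -> dot barycenter c <= b.
Proof.
move=> h; rewrite dot_barycenter mulrC ler_pdivrMr ?ltr0n//.
rewrite [leRHS]mulr_natr -[m.+1 in leRHS]card_ord -sumr_const; exact: ler_sum.
Qed.

(** An average of numbers at most [b] reaches [b] only if all of them do. Hence the barycenter of
    finitely many points is strict in every inequality that is strict at one of them. *)
Lemma barycenter_tight c b : (forall i, dot (x i) c <= b) -> dot barycenter c = b ->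
  forall i, dot (x i) c = b.
Proof.
move=> h e i; apply/eqP; rewrite eq_le h/= leNgt; apply/negP => lt.
have : \sum_i dot (x i) c < \sum_(i < m.+1) b.
  rewrite (bigD1 i)//= [ltRHS](bigD1 i)//=; apply: ltr_leD => //; exact: ler_sum.
rewrite sumr_const card_ord -e -mulr_natl dot_barycenter mulrA divff// mul1r.
by rewrite ltxx.
Qed.

End Barycenter.

Section HPoly.
Variables (R : realType) (d m : nat).
Local Notation V := 'rV[R]_d.
Variables (u : 'I_m -> V) (tau : 'I_m -> R).

Definition tight (x : V) : {set 'I_m} := [set i | dot x (u i) == tau i]%SET.

(** Linear independence of the normals in [J], stated as surjectivity of the evaluation map, since
    it serves to prescribe scalar products with these normals. *)
Definition normals_solvable (J : {set 'I_m}) : Prop := forall beta : 'I_m -> R,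
  exists v, forall i, i \in J -> dot v (u i) = beta i.

Definition normals_span (J : {set 'I_m}) : Prop :=
  forall w, (forall i, i \in J -> dot w (u i) = 0) -> w = 0.

Definition norm_bounded (Q : set V) : Prop := exists M, forall x, Q x -> `|x| <= M.

Lemma tightP x i : reflect (dot x (u i) = tau i) (i \in tight x).
Proof. by rewrite inE; exact: eqP. Qed.

Lemma slack x i : hpoly u tau x -> i \notin tight x -> dot x (u i) < tau i.
Proof. by move=> Px; rewrite inE lt_neqAle Px andbT. Qed.

(** The ratio test of the simplex method: boundedness forces some inequality to be used up along
    [w], and the step ends at the first one that becomes tight. *)
Lemma push x w : norm_bounded (hpoly u tau) -> hpoly u tau x -> w != 0 ->
  (forall i, i \in tight x -> dot w (u i) = 0) ->
  exists t, [/\ 0 < t, hpoly u tau (x + t *: w) & tight x \proper tight (x + t *: w)].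
Proof.
move=> [M Mb] Px w0 xw.
have [i0 i0w] : exists i, 0 < dot w (u i).
  apply/not_existsP => h.
  have w0' : 0 < `|w| by rewrite normr_gt0.
  have M0 : 0 <= M by apply: le_trans (Mb _ Px).
  (* Without an obstacle, [x + t *: w] would be a point of the polyhedron at distance [2 * M + 1]
     from [x], beyond its diameter. *)
  pose t := (M + M + 1) / `|w|.
  have t0 : 0 <= t by rewrite divr_ge0// !addr_ge0.
  have /Mb : hpoly u tau (x + t *: w).
    move=> i; rewrite dotDl dotZl (le_trans _ (Px i))// gerDl mulr_ge0_le0//.
    by rewrite leNgt; apply/negP/h.
  have := Mb _ Px.
  have : `|t *: w| <= `|x + t *: w| + `|x|.
    by have := ler_normB (x + t *: w) x; rewrite addrAC subrr add0r.
  rewrite normrZ ger0_norm// /t divfK ?gt_eqF//; lra.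
pose f i := (tau i - dot x (u i)) / dot w (u i).
case: (@arg_minP _ _ _ i0 (fun i => 0 < dot w (u i)) f i0w) => i iw imin.
have ix : i \notin tight x.
  by apply/negP => /xw h; rewrite h ltxx in iw.
have fi : 0 < f i by rewrite divr_gt0// subr_gt0 slack.
exists (f i); split=> // [j|].
  rewrite dotDl dotZl -lerBrDl; have [jw|jw] := ltP 0 (dot w (u j)).
    by rewrite -ler_pdivlMr//; exact: imin.
  by rewrite (@le_trans _ _ 0) ?subr_ge0// mulr_ge0_le0// ltW.
apply/properP; split.
  apply/fintype.subsetP => j jx; rewrite inE dotDl dotZl xw// mulr0 addr0.
  exact/eqP/tightP.
exists i => //; apply/tightP; rewrite dotDl dotZl /f divfK ?gt_eqF//.
exact: subrKC.
Qed.

(* Moving along a direction orthogonal to the tight normals makes a further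
   inequality tight. *)
Lemma exists_basic_point x : norm_bounded (hpoly u tau) -> hpoly u tau x ->
  exists v, [/\ hpoly u tau v, tight x \subset tight v & normals_span (tight v)].
Proof.
move=> bQ Px.
have [n] := ubnP (m - #|tight x|); elim: n x Px => // n IH x Px xn.
have [sx|] := pselect (normals_span (tight x)); first by exists x.
move=> /existsNP[w /not_implyP[xw /eqP w0]].
have [t [_ Pt /[dup] prop /proper_card xt]] := push bQ Px w0 xw.
have [|v [Pv xv sv]] := IH _ Pt.
  have : (#|tight (x + t *: w)| <= m)%N by rewrite -[leqRHS]card_ord max_card.
  move: xt xn; lia.
by exists v; split => //; apply: fintype.subset_trans xv; exact: proper_sub.
Qed.

Definition tight_face (J : {set 'I_m}) : set V :=
  hpoly u tau `&` [set x | J \subset tight x].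

Lemma tight_face_face J : face (hpoly u tau) (tight_face J).
Proof.
(* The sum of the inequalities in [J] is an equality exactly where each of them is, so the sum of
   the normals exposes the face. *)
exists (\sum_(i in J) u i), (\sum_(i in J) tau i).
have sumE (y : V) : dot (\sum_(i in J) u i) y = \sum_(i in J) dot y (u i).
  by rewrite dotC dot_sumr.
split=> [y Py|]; first by rewrite sumE; apply: ler_sum => i _; exact: Py.
apply/seteqP; split=> y [Py /=].
  move=> /fintype.subsetP Jy; split=> //=; rewrite sumE; apply: eq_bigr => i /Jy.
  exact/tightP.
rewrite sumE => /eqP; rewrite -subr_eq0 -sumrB => /eqP h; split=> //=.
apply/fintype.subsetP => i iJ.
apply/tightP/esym/eqP; rewrite -subr_eq0; apply/eqP.
apply: (@psumr_eq0P _ _ (fun i => i \in J) (fun i => tau i - dot y (u i))) iJ.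
  by move=> j _; rewrite subr_ge0.
apply/eqP; rewrite -oppr_eq0 -sumrN; under eq_bigr do rewrite opprB.
exact/eqP.
Qed.

Lemma basic_vertex v : hpoly u tau v -> normals_span (tight v) -> vertex (hpoly u tau) v.
Proof.
move=> Pv sv; rewrite /vertex (_ : [set v] = tight_face (tight v)).
  exact: tight_face_face.
apply/seteqP; split=> [_ ->|y [Py /= /fintype.subsetP vy]]; first by split=> /=.
apply/eqP; rewrite -subr_eq0; apply/eqP/sv => i iv.
by rewrite dotBl (tightP _ _ iv) (tightP _ _ (vy _ iv)) subrr.
Qed.

Lemma normals_solvable_sub (J K : {set 'I_m}) :
  J \subset K -> normals_solvable K -> normals_solvable J.
Proof.
by move=> /fintype.subsetP JK sK b; have [v vP] := sK b; exists v => i /JK/vP.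
Qed.

(** Spanning gives the matrix of normals rank [d]; as it has at most [d] columns, its column rank is
    full as well. *)
Lemma span_solvable (J : {set 'I_m}) : (#|J| <= d)%N -> normals_span J ->
  normals_solvable J.
Proof.
move=> cJ sJ b.
pose M : 'M[R]_(d, #|J|) := \matrix_(i, j) u (enum_val j) ord0 i.
have ME (w : V) j : (w *m M) ord0 j = dot w (u (enum_val j)).
  by rewrite !mxE; apply: eq_bigr => i _; rewrite !mxE.
have Mfree : row_free M.
  apply/row_freeP; apply/row_freeP; rewrite -kermx_eq0; apply/eqP/row_matrixP => i.
  rewrite row0; apply: sJ => k kJ.
  have := ME (row i (kermx M)) (enum_rank_in kJ k).
  by rewrite enum_rankK_in// => <-; rewrite -row_mul mulmx_ker row0 mxE.
have Mfull : row_full M.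
  by rewrite /row_full eqn_leq rank_leq_col/=; move: Mfree => /eqP ->.
have /submxP[v vE] : ((\row_j b (enum_val j) : 'rV[R]_#|J|) <= M)%MS.
  exact: submx_full.
exists v => i iJ; move/rowP: vE => /(_ (enum_rank_in iJ i)).
by rewrite ME !mxE enum_rankK_in.
Qed.

End HPoly.

Section FacetRep.
Variables (R : realType) (d : nat).
Local Notation V := 'rV[R]_d.

Lemma polytope_bounded (Q : set V) : polytope Q -> norm_bounded Q.
Proof.
move=> [k [p ->]]; exists (\sum_i `|p i|) => x [a [a0 a1 ->]].
apply: (le_trans (ler_norm_sum _ _ _)); apply: ler_sum => i _.
rewrite normrZ ger0_norm// ler_piMl//.
by rewrite -a1 (bigD1 i)//= lerDl sumr_ge0.
Qed.

(** With the least possible number of inequalities, dropping any one admits a new point [y]. A zero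
    normal would make its inequality hold everywhere, as it holds at a point of [Q]; so all normals
    can be scaled to unit length. *)
Lemma minimal_halfspaces (Q : set V) : (0 < d)%N -> polytope Q -> has_dim Q d ->
  exists m (u : 'I_m -> V) (tau : 'I_m -> R),
  [/\ Q = hpoly u tau, forall i, sphere (u i) & forall j, exists2 y, ~ Q y &
      forall i, i != j -> dot y (u i) <= tau i].
Proof.
move=> d0 [k [p QE]] dQ.
pose S m := exists (u : 'I_m -> V) (tau : 'I_m -> R), Q = hpoly u tau.
have : exists m, `[< S m >].
  have [m [u [tau e]]] := convex_hull_hpoly p.
  by exists m; apply/asboolP; exists u, tau; rewrite QE.
move=> /ex_minnP[m /asboolP[u [tau QP]] mmin].
have irr : forall j, exists2 y, ~ Q y & forall i, i != j -> dot y (u i) <= tau i.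
  move=> j; apply: contrapT; move: j.
  case: m u tau QP mmin => [|m] u tau QP mmin j h; first by have := ltn_ord j.
  have : (m.+1 <= m)%N.
    apply: mmin; apply/asboolP; exists (u \o lift j), (tau \o lift j).
    rewrite QP; apply/seteqP; split=> [x xP i|x xP]; first exact: xP.
    apply: contrapT; rewrite -QP => nQx; apply: h; exists x => // i ij.
    by case: (unliftP j i) ij => [l ->|->]; [move=> _; exact: xP|rewrite eqxx].
  by rewrite ltnn.
have [x0 Qx0] : exists x, Q x.
  apply: contrapT => /forallNP nQ.
  apply: (@full_dim_not_subset _ _ Q (delta_mx ord0 (Ordinal d0)) 0 dQ) => [|x /nQ//].
  by apply/eqP => /rowP/(_ (Ordinal d0))/eqP; rewrite !mxE !eqxx oner_eq0.
have u0 i : u i != 0.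
  apply/eqP => ui; have [y nQy yP] := irr i.
  apply: nQy; rewrite QP => l; have [->|li] := eqVneq l i; last exact: yP.
  by move: Qx0; rewrite QP ui dot0r => /(_ i); rewrite ui dot0r.
pose nu i := Num.sqrt (dot (u i) (u i)).
have nu0 i : 0 < nu i by rewrite sqrtr_gt0 lt_neqAle eq_sym dot_eq0 u0 dot_ge0.
exists m, (fun i => (nu i)^-1 *: u i), (fun i => (nu i)^-1 * tau i).
have le_scale y i : (dot y ((nu i)^-1 *: u i) <= (nu i)^-1 * tau i) = (dot y (u i) <= tau i).
  by rewrite dotZr ler_pM2l// invr_gt0.
split=> [|i|j].
- by rewrite QP; apply/seteqP; split=> x xP i; move: (xP i); rewrite le_scale.
- apply/sphereE; rewrite dotZl dotZr mulrA -expr2 exprVn sqr_sqrtr ?dot_ge0// mulVf//.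
  by rewrite dot_eq0.
by have [y nQy yP] := irr j; exists y => // i ij; rewrite le_scale yP.
Qed.

(** By full dimension no inequality is tight on the whole polyhedron; the barycenter of one strict
    witness for each inequality is strict in all. *)
Lemma strict_point m (u : 'I_m -> V) (tau : 'I_m -> R) :
  has_dim (hpoly u tau) d -> (forall i, sphere (u i)) ->
  exists x0, forall i, dot x0 (u i) < tau i.
Proof.
move=> dQ su.
have /choice[x xP] : forall i, exists x, hpoly u tau x /\ dot x (u i) < tau i.
  move=> i; apply: contrapT => h.
  apply: (full_dim_not_subset (u := u i) (t := tau i) dQ).
    by apply/eqP => ui; move/sphereE: (su i); rewrite ui dot0l => /esym/eqP; rewrite oner_eq0.
  move=> x Px /=; apply/eqP; rewrite eq_le Px leNgt/=; apply/negP => lt.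
  by apply: h; exists x.
case: m u tau dQ su x xP => [|m] u tau dQ su x xP; first by exists 0; case.
exists (barycenter x) => i.
rewrite lt_neqAle barycenter_le ?andbT => [|j]; last by have [+ _] := xP j.
apply/eqP => h; have [_] := xP i; rewrite (barycenter_tight _ h) ?ltxx// => j.
by have [+ _] := xP j.
Qed.

(** The segment from an interior point [x0] to a point [y] violating only inequality [j] crosses the
    [j]-th hyperplane at a point [z] strict in all other inequalities. Near [z] that hyperplane
    stays inside [Q], so the face has dimension [d.-1]; also [z] lies on no other face [F i], which
    gives injectivity. *)
Lemma facets m (u : 'I_m -> V) (tau : 'I_m -> R) (Q := hpoly u tau) :
  has_dim Q d -> (forall i, sphere (u i)) ->
  (forall j, exists2 y, ~ Q y & forall i, i != j -> dot y (u i) <= tau i) ->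
  exists F : 'I_m -> set V, [/\ injective F, forall i, facet Q (F i) &
    forall i x, Q x -> (F i x <-> i \in tight u tau x)].
Proof.
move=> dQ su irr.
have [x0 x0P] := strict_point dQ su.
pose F i := Q `&` [set x | dot x (u i) = tau i].
have zP j : exists z, dot z (u j) = tau j /\ forall i, i != j -> dot z (u i) < tau i.
  have [y nQy yP] := irr j.
  have yj : tau j < dot y (u j).
    rewrite ltNge; apply/negP => yj; apply: nQy => i.
    by have [->|/yP] := eqVneq i j.
  pose s := (tau j - dot x0 (u j)) / (dot y (u j) - dot x0 (u j)).
  have den : 0 < dot y (u j) - dot x0 (u j) by rewrite subr_gt0 (lt_trans (x0P j)).
  have s1 : s < 1 by rewrite ltr_pdivrMr// mul1r ltrD2r.
  have s0 : 0 < s by rewrite divr_gt0// subr_gt0.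
  have zE i : dot (x0 + s *: (y - x0)) (u i) = dot x0 (u i) + s * (dot y (u i) - dot x0 (u i)).
    by rewrite dotDl dotZl dotBl.
  exists (x0 + s *: (y - x0)); split=> [|i ij]; rewrite zE.
    by rewrite /s divfK ?gt_eqF// addrC subrK.
  have := yP _ ij; have := x0P i; nra.
exists F; split.
- move=> i j Fij; apply: contrapT => /eqP ij.
  have [z [zi zl]] := zP i.
  have : F i z by split=> // l; have [->|/zl/ltW//] := eqVneq l i; rewrite zi.
  by rewrite Fij => -[_ /= zj]; have := zl j; rewrite eq_sym zj ltxx => /(_ ij).
- move=> i; split.
    exists (u i), (tau i); split=> [x Px|]; first by rewrite dotC; exact: Px.
    by congr (_ `&` _); apply/seteqP; split=> x /=; rewrite dotC.
  have ui : u i != 0.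
    by apply/eqP => ui; move/sphereE: (su i); rewrite ui dot0l => /esym/eqP; rewrite oner_eq0.
  have [L dL hL] := orthogonal_vspace ui.
  have [z [zi zl]] := zP i.
  exists z, L; split=> //; apply: (affine_hull_relative_open hL).
  + by move=> x [_ /= ->]; rewrite zi.
  + by split=> // l; have [->|/zl/ltW//] := eqVneq l i; rewrite zi.
  move=> w wi.
  (* A step [e / M] along [w] changes each scalar product by at most [e], the least slack at [z];
     the summand 1 keeps [M] positive. *)
  pose M := \sum_l `|dot w (u l)| + 1.
  have M0 : 0 < M by rewrite ltr_wpDl// sumr_ge0.
  pose e := \big[Order.min/1]_(l | l != i) (tau l - dot z (u l)).
  have e0 : 0 < e by apply: lt_bigmin => // l li; rewrite subr_gt0 zl.
  exists (e / M); first by rewrite gt_eqF// divr_gt0.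
  split; last by rewrite /= dotDl dotZl wi mulr0 addr0.
  move=> l; rewrite dotDl dotZl; have [->|li] := eqVneq l i.
    by rewrite wi mulr0 addr0 zi.
  rewrite -lerBrDl; apply: (@le_trans _ _ e); last exact: bigmin_le_cond.
  rewrite mulrAC ler_pdivrMr// ler_wpM2l//; first exact: ltW.
  apply: (le_trans (ler_norm _)); rewrite /M (bigD1 l)//= -addrA lerDl.
  by rewrite addr_ge0// sumr_ge0.
- by move=> i x Qx; split=> [[_ /= xi]|/tightP xi]; [exact/tightP|].
Qed.

(** Every tight set is contained in that of a vertex whose tight normals span. There, distinct tight
    inequalities give distinct facets through the vertex, so simplicity allows at most [d] of them
    and [span_solvable] applies. *)
Lemma simple_halfspaces (Q : set V) : (0 < d)%N -> simple_dpolytope Q ->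
  exists m (u : 'I_m -> V) (tau : 'I_m -> R),
  [/\ Q = hpoly u tau, forall i, sphere (u i), injective (fun i => (u i, tau i)),
      forall x, Q x -> normals_solvable u (tight u tau x) &
      exists x0, forall i, dot x0 (u i) < tau i].
Proof.
move=> d0 [pQ dQ sQ].
have bQ := polytope_bounded pQ.
have [m [u [tau [QE su irr]]]] := minimal_halfspaces d0 pQ dQ.
subst Q; exists m, u, tau; split=> //; last exact: strict_point.
  move=> i j [ui ti]; apply: contrapT => /eqP ij.
  have [y nQy yP] := irr j; apply: nQy => l; have [->|/yP//] := eqVneq l j.
  by rewrite -ui -ti yP.
move=> x Px.
have [v [Pv xv spv]] := exists_basic_point bQ Px.
apply: (normals_solvable_sub xv); apply: span_solvable => //.
have [F [Finj fF FP]] := facets dQ su irr.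
have SI := sQ _ (basic_vertex Pv spv).
set S := [set G | _] in SI.
have Sfin : finite_set S by apply/finite_setP; exists d.
rewrite -[leqRHS](card_fset_set SI) cardE -(size_map F).
apply: uniq_leq_size; first by rewrite map_inj_uniq ?enum_uniq.
move=> G /mapP[i]; rewrite mem_enum => iv ->.
rewrite in_fset_set// in_setE; split=> //.
exact/FP.
Qed.

End FacetRep.

(** * Faces and their stability under perturbation *)

Section SmallStep.
Variable R : realType.

Lemma small_step (I : finType) (P : pred I) (a s : I -> R) :
  (forall i, P i -> 0 < s i) ->
  exists t, [/\ 0 < t, t <= 1 & forall i, P i -> t * a i < s i].
Proof.
move=> s0.
pose e := \big[Order.min/1]_(i | P i) (s i / (`|a i| + 1)).
have a0 i : 0 < `|a i| + 1 by rewrite ltr_wpDl.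
exists e; split.
- by apply: lt_bigmin => // i Pi; rewrite divr_gt0// s0.
- exact: bigmin_le_id.
move=> i Pi.
have e0 : 0 < e by apply: lt_bigmin => // j Pj; rewrite divr_gt0// s0.
apply: (@lt_le_trans _ _ (e * (`|a i| + 1))).
  by rewrite ltr_pM2l// ltr_pwDr// ler_norm.
by rewrite -ler_pdivlMr//; exact: bigmin_le_cond.
Qed.

(** [E] shrinks the sup norm by a factor of at least 2, so [1 + E] is injective and its inverse has
    norm at most 2. *)
Lemma near_identity_solve m (E : 'M[R]_m) (eta b : R) (beta : 'rV[R]_m) :
  (forall i j, `|E i j| <= eta) -> m%:R * eta <= 2^-1 -> `|beta| <= b ->
  exists2 s : 'rV[R]_m, `|s| <= 2 * b & s + s *m E = beta.
Proof.
move=> Eeta meta bb.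
have sE (s : 'rV[R]_m) : `|s *m E| <= 2^-1 * `|s|.
  apply: norm_le_coord => [|i]; first by rewrite mulr_ge0 ?invr_ge0.
  rewrite mxE; apply: (le_trans (ler_norm_sum _ _ _)).
  apply: (@le_trans _ _ (\sum_(j < m) `|s| * eta)).
    by apply: ler_sum => j _; rewrite normrM ler_pM ?coord_norm.
  rewrite sumr_const card_ord -[_ *+ m]mulr_natl.
  by rewrite (mulrC `|s|) mulrA ler_wpM2r.
have half (s : 'rV[R]_m) : `|s| <= 2 * `|s + s *m E|.
  have := sE s; have := ler_normB (s + s *m E) (s *m E); rewrite addrK; lra.
pose C := 1%:M + E.
have CE (s : 'rV[R]_m) : s *m C = s + s *m E by rewrite mulmxDr mulmx1.
have Cu : C \in unitmx.
  rewrite -row_free_unit -kermx_eq0; apply/eqP/row_matrixP => i.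
  have := half (row i (kermx C)); rewrite -CE -row_mul mulmx_ker !row0 normr0 mulr0.
  by rewrite normr_le0 => /eqP.
exists (beta *m invmx C); last by rewrite -CE mulmxKV.
by rewrite (le_trans (half _))// -CE mulmxKV// ler_pM2l.
Qed.

End SmallStep.

Section Faces.
Variables (R : realType) (d m : nat).
Local Notation V := 'rV[R]_d.
Variables (u : 'I_m -> V) (tau : 'I_m -> R).
Local Notation P := (hpoly u tau).

Definition common_tight (F : set V) : {set 'I_m} :=
  [set i | `[< forall x, F x -> dot x (u i) = tau i >]]%SET.

Lemma common_tightP F i :
  reflect (forall x, F x -> dot x (u i) = tau i) (i \in common_tight F).
Proof. by rewrite inE; exact: asboolP. Qed.

(** Take the barycenter of one witness in [F] for each inequality not tight on all of [F]. The extra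
    point [x0] keeps this family nonempty. *)
Lemma face_relative_interior F : face P F -> F !=set0 ->
  exists2 x, F x & tight u tau x = common_tight F.
Proof.
move=> [c [b [cP FE]]] [x0 Fx0].
have FP x : F x -> P x by rewrite FE => -[].
have /choice[x xP] : forall i, exists x, F x /\ (i \notin common_tight F -> dot x (u i) <> tau i).
  move=> i; have [iF|/common_tightP/existsNP[x /not_implyP[Fx xi]]] := boolP (i \in common_tight F).
    by exists x0.
  by exists x.
pose y (k : 'I_m.+1) := if unlift ord0 k is Some i then x i else x0.
have Fy k : F (y k) by rewrite /y; case: unlift => // i; have [] := xP i.
exists (barycenter y).
  rewrite FE; split=> [i|/=]; first by apply: barycenter_le => k; exact: (FP _ (Fy k)).
  rewrite dotC; apply: barycenter_eq => k; rewrite dotC.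
  by have := Fy k; rewrite FE => -[].
apply/setP => i; apply/tightP/common_tightP => [yi z Fz|Fi].
  apply: contrapT => zi.
  have /(_ (lift ord0 i)) := barycenter_tight (fun k => FP _ (Fy k) i) yi.
  rewrite /y liftK; have [_] := xP i; apply.
  by apply/common_tightP => /(_ _ Fz).
by apply: barycenter_eq => k; exact: Fi.
Qed.

Lemma faceE F : face P F -> F !=set0 -> F = tight_face u tau (common_tight F).
Proof.
move=> fF F0; have [x Fx xF] := face_relative_interior fF F0.
case: (fF) => c [b [cP FE]].
have [Px /= xb] : (P `&` [set x | dot c x = b]) x by rewrite -FE.
apply/seteqP; split=> [y Fy|y [Py /= Fy]].
  split; first by move: Fy; rewrite FE => -[].
  by apply/fintype.subsetP => i /common_tightP Fi; exact/tightP/Fi.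
rewrite FE; split=> //=; apply/eqP; rewrite eq_le cP//=.
(* From a relatively interior point one can move a little away from y. *)
have [t [t0 _ tP]] := @small_step _ _ (fun i => i \notin tight u tau x)
  (fun i => dot x (u i) - dot y (u i)) (fun i => tau i - dot x (u i)) 
  (fun i ix => ltac:(rewrite subr_gt0; exact: slack Px ix)).
have /cP : P (x + t *: (x - y)).
  move=> i; rewrite dotDl dotZl dotBl; have [ix|ix] := boolP (i \in tight u tau x).
    rewrite (tightP _ _ _ _ ix) (_ : dot y (u i) = tau i) ?subrr ?mulr0 ?addr0//.
    by apply/tightP; move/fintype.subsetP: Fy; apply; rewrite -xF.
  by rewrite -lerBrDl ltW// tP.
by rewrite dotDr dotZr dotBr xb gerDl pmulr_rle0// subr_le0.
Qed.

End Faces.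

Section CombIso.
Variables (R : realType) (d m : nat).
Local Notation V := 'rV[R]_d.

(* The relatively interior points of a face F have the tight set
   common_tight F, so this family, ordered by reverse inclusion, is the lattice
   of nonempty faces. *)
Definition tight_family (u : 'I_m -> V) (tau : 'I_m -> R) : set {set 'I_m} :=
  [set tight u tau x | x in hpoly u tau].

(** The face of the second polyhedron with the same common tight set. The empty face is treated
    apart: its common tight set is all of ['I_m], which can also be tight at an actual point. *)
Definition transfer (u u' : 'I_m -> V) (tau tau' : 'I_m -> R) (F : set V) : set V :=
  [set y | F !=set0 /\ tight_face u' tau' (common_tight u tau F) y].

Section Transfer.
Variables (u u' : 'I_m -> V) (tau tau' : 'I_m -> R).
Hypothesis eqT : tight_family u tau = tight_family u' tau'.
Local Notation P := (hpoly u tau).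
Local Notation P' := (hpoly u' tau').

Lemma transfer0 : transfer u u' tau tau' set0 = set0.
Proof. by apply/seteqP; split=> // y [[]]. Qed.

Lemma transfer_face F : face P F -> face P' (transfer u u' tau tau' F).
Proof.
move=> fF; have [->|/set0P F0] := eqVneq F set0.
  rewrite transfer0; exists 0, 1; split=> [x _|]; first by rewrite dot0l.
  by apply/seteqP; split=> // x [_ /=]; rewrite dot0l => /eqP; rewrite eq_sym oner_eq0.
have -> : transfer u u' tau tau' F = tight_face u' tau' (common_tight u tau F).
  by apply/seteqP; split=> [y []|y].
exact: tight_face_face.
Qed.

Lemma transfer_common F : face P F -> F !=set0 ->
  transfer u u' tau tau' F !=set0 /\
  common_tight u' tau' (transfer u u' tau tau' F) = common_tight u tau F.
Proof.
move=> fF F0; have [x Fx xF] := face_relative_interior fF F0.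
have Px : P x by case: fF => c [b [_ FE]]; move: Fx; rewrite FE => -[].
have : tight_family u tau (tight u tau x) by exists x.
rewrite eqT => -[y Py yx].
have fFy : transfer u u' tau tau' F y by split=> //; split=> //=; rewrite yx xF.
split; first by exists y.
apply/setP => i; apply/idP/idP => [/common_tightP/(_ _ fFy)/eqP h|iF].
  by rewrite -xF -yx inE.
by apply/common_tightP => z [_ [_ /= /fintype.subsetP Fz]]; exact/tightP/Fz.
Qed.

Lemma transfer_sub F G : face P F -> face P G -> F `<=` G ->
  transfer u u' tau tau' F `<=` transfer u u' tau tau' G.
Proof.
move=> fF fG FG y [[x Fx] [Py /= Fy]]; split; first by exists x; exact: FG.
split=> //=; apply: fintype.subset_trans Fy.
by apply/fintype.subsetP => i /common_tightP Gi; apply/common_tightP => z /FG/Gi.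
Qed.

End Transfer.

Lemma transferK u u' tau tau' F : tight_family u tau = tight_family u' tau' ->
  face (hpoly u tau) F -> transfer u' u tau' tau (transfer u u' tau tau' F) = F.
Proof.
move=> eqT fF; have [->|/set0P F0] := eqVneq F set0.
  by rewrite !transfer0.
have [fF0 cE] := transfer_common eqT fF F0.
rewrite [RHS](faceE fF F0) -cE.
by apply/seteqP; split=> [y []|y].
Qed.

Lemma tight_family_combinatorially_isomorphic (u u' : 'I_m -> V) (tau tau' : 'I_m -> R) :
  tight_family u tau = tight_family u' tau' ->
  combinatorially_isomorphic (hpoly u tau) (hpoly u' tau').
Proof.
move=> eqT; exists (transfer u u' tau tau'); split; first split.
- by move=> F; exact: transfer_face.
- move=> F G /set_mem fF /set_mem fG FG.
  by rewrite -(transferK eqT fF) FG transferK.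
- move=> G fG; exists (transfer u' u tau' tau G); first exact: transfer_face.
  exact: transferK.
move=> F G fF fG; split; first exact: transfer_sub.
rewrite -{2}(transferK eqT fF) -{2}(transferK eqT fG).
by apply: transfer_sub; exact: transfer_face.
Qed.

End CombIso.

Section Stability.
Variables (R : realType) (d m : nat).
Local Notation V := 'rV[R]_d.
Variables (u : 'I_m -> V) (tau : 'I_m -> R) (x0 : V).
Local Notation P := (hpoly u tau).
Hypothesis bP : norm_bounded P.
Hypothesis x0P : forall i, dot x0 (u i) < tau i.
Hypothesis solvP : forall x, P x -> normals_solvable u (tight u tau x).

Definition close_to (e : R) (u' : 'I_m -> V) (tau' : 'I_m -> R) : Prop :=
  forall i, `|u' i - u i| < e /\ `|tau' i - tau i| < e.

Lemma close_to_le e e' u' tau' : e <= e' -> close_to e u' tau' -> close_to e' u' tau'.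
Proof. by move=> ee h i; have [h1 h2] := h i; rewrite !(lt_le_trans _ ee). Qed.

Lemma close_to_dot e u' tau' x i : close_to e u' tau' ->
  `|(dot x (u' i) - tau' i) - (dot x (u i) - tau i)| < e * (1 + d%:R * `|x|).
Proof.
move=> /(_ i)[ui ti].
rewrite (_ : _ - _ = dot x (u' i - u i) - (tau' i - tau i)); last by rewrite dotBr; ring.
apply: (le_lt_trans (ler_normB _ _)); rewrite addrC mulrDr mulr1.
apply: ltr_leD => //; apply: (le_trans (dot_norm _ _)).
by rewrite mulrC ler_wpM2r ?mulr_ge0// ltW.
Qed.

Lemma close_strict_bounded : exists e M, [/\ 0 < e, 0 <= M &
  forall u' tau', close_to e u' tau' -> (forall i, dot x0 (u' i) < tau' i) /\
    forall x, hpoly u' tau' x -> `|x| <= M].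
Proof.
have [M0 M0P] := bP.
have M00 : 0 <= M0 by apply: le_trans (M0P x0 _) => // i; exact: ltW.
(* Half of [r] exceeds [M0 + |x0|], so no point of [P] has distance [r / 2] from [x0]. *)
pose r := 2 * (M0 + `|x0|) + 1.
have r0 : 0 < r by rewrite ltr_wpDl// mulr_ge0// addr_ge0.
pose M := `|x0| + r.
have M_ge0 : 0 <= M by rewrite addr_ge0// ltW.
have [e [e0 _ eP]] := @small_step R 'I_m xpredT (fun=> 1 + d%:R * M)
  (fun i => tau i - dot x0 (u i)) (fun i _ => ltac:(by rewrite subr_gt0)).
have x0M : e * (1 + d%:R * `|x0|) <= e * (1 + d%:R * M).
  by rewrite ler_pM2l// lerD2l ler_wpM2l// lerDl ltW.
exists e, M; split=> // u' tau' cl.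
have x0' i : dot x0 (u' i) < tau' i.
  have := close_to_dot x0 i cl; rewrite ltr_norml => /andP[_].
  have := eP i isT; lra.
split=> // x Px; apply: contrapT => /negP; rewrite -ltNge => Mx.
(* A point x outside the ball would give a point y of P, halfway between x0
   and the point z of the segment [x0, x] at distance r, with norm > M0. *)
have rx : r < `|x - x0|.
  by have := lerB_dist x x0; rewrite /M in Mx; lra.
have rx0 : 0 < `|x - x0| by exact: lt_trans rx.
pose s := r / `|x - x0|.
have s1 : s < 1 by rewrite ltr_pdivrMr// mul1r.
have s0 : 0 < s by rewrite divr_gt0.
pose z := x0 + s *: (x - x0).
have zr : `|z - x0| = r.
  by rewrite /z addrAC subrr add0r normrZ gtr0_norm// divfK ?gt_eqF.
have zM : `|z| <= M.
  by rewrite /M -zr addrC -{1}(subrK x0 z); exact: ler_normD.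
have Pz i : dot z (u' i) <= tau' i.
  rewrite /z dotDl dotZl dotBl; have := x0' i; have := Px i; nra.
(* [z] satisfies the unperturbed inequalities up to an error smaller than the slack of [x0];
   averaging the two points absorbs this error. *)
pose y := x0 + 2^-1 *: (z - x0).
have /M0P : P y.
  move=> i; rewrite dotDl dotZl dotBl.
  have := close_to_dot z i cl; rewrite ltr_norml => /andP[+ _].
  have : e * (1 + d%:R * `|z|) <= e * (1 + d%:R * M).
    by rewrite ler_pM2l// lerD2l ler_wpM2l.
  have := eP i isT; have := Pz i; lra.
have : `|y - x0| = 2^-1 * r.
  by rewrite /y addrAC subrr add0r normrZ zr ger0_norm// invr_ge0.
have := ler_normB y x0; rewrite /r; lra.
Qed.

(** The family is closed under subsets: by independence some direction keeps [J] tight and strictly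
    relaxes the other inequalities tight at [x]. *)
Lemma tight_family_sub x (J : {set 'I_m}) : P x -> J \subset tight u tau x -> tight_family u tau J.
Proof.
move=> Px Jx.
have [v vP] := solvP Px (fun i => if i \in J then 0 else -1).
have [t [t0 _ tP]] := @small_step _ _ (fun i => i \notin tight u tau x)
  (fun i => dot v (u i)) (fun i => tau i - dot x (u i)) 
  (fun i ix => ltac:(rewrite subr_gt0; exact: slack Px ix)).
have xvE i : dot (x + t *: v) (u i) = dot x (u i) + t * dot v (u i).
  by rewrite dotDl dotZl.
have xvP i : dot (x + t *: v) (u i) <= tau i /\
    (dot (x + t *: v) (u i) = tau i <-> i \in J).
  rewrite xvE; have [ix|ix] := boolP (i \in tight u tau x).
    rewrite vP// (tightP _ _ _ _ ix); case: ifP => iJ.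
      by rewrite mulr0 addr0.
    rewrite mulrN1 gerBl ltW//; split=> //; split=> // /eqP.
    by rewrite -subr_eq0 addrAC subrr add0r oppr_eq0 gt_eqF.
  have lt : dot x (u i) + t * dot v (u i) < tau i by rewrite -ltrBrDl tP.
  split; first exact: ltW.
  split=> [h|iJ]; first by rewrite h ltxx in lt.
  by move/fintype.subsetP/(_ _ iJ): Jx; rewrite (negbTE ix).
exists (x + t *: v); first by move=> i; have [] := xvP i.
by apply/setP => i; have [_ h] := xvP i; apply/tightP/idP => /h.
Qed.

(* The perturbed tight equations are solved near x along vectors w_j dual to the
   normals u_i; in these coordinates the system is close to the identity. *)
Lemma tight_family_persists (J : {set 'I_m}) : tight_family u tau J ->
  exists2 e, 0 < e & forall u' tau', close_to e u' tau' -> tight_family u' tau' J.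
Proof.
move=> [x Px xJ].
have /choice[w wP] : forall j, exists w, (j \notin J -> w = 0) /\
    forall i, i \in J -> dot w (u i) = (i == j)%:R.
  move=> j; have [jJ|jJ] := boolP (j \in J).
    have [w wP] := solvP Px (fun i => (i == j)%:R).
    by exists w; split=> // i; rewrite -xJ; exact: wP.
  exists 0; split=> // i iJ; rewrite dot0l; case: eqVneq => // ij.
  by rewrite ij (negbTE jJ) in iJ.
pose W := \sum_j `|w j|.
pose U := \sum_j `|u j|.
have W0 : 0 <= W by exact: sumr_ge0.
have wW j : `|w j| <= W by rewrite /W (bigD1 j)//= lerDl sumr_ge0.
have uU j : `|u j| <= U by rewrite /U (bigD1 j)//= lerDl sumr_ge0.
(* The displacement from [x] to the new point will be at most [e * c1]: the defect [beta] is at most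
   [e * (1 + d * |x|)], inverting costs the factor 2, and [W] bounds the dual vectors. Then [c2]
   bounds the new point, as [e <= 1]. *)
pose c1 := 2 * (1 + d%:R * `|x|) * W.
have c10 : 0 <= c1 by rewrite !mulr_ge0// addr_ge0// mulr_ge0.
pose c2 := `|x| + c1.
(* The slack outside [J] has to cover two errors: the displacement of the point, [d * c1 * U], and
   the perturbation of the data, [1 + d * c2], both times [e]. *)
have [e1 [e10 e11 e1P]] := @small_step _ _ (fun i => i \notin J)
  (fun i => d%:R * c1 * U + (1 + d%:R * c2)) (fun i => tau i - dot x (u i)) 
  (fun i ix => ltac:(rewrite subr_gt0; apply: slack => //; by rewrite xJ)).
(* [e * D <= 1] is the smallness condition of [near_identity_solve] for the entries of [E], which
   are at most [d * W * e]. *)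
pose D := 2 * (m%:R * (d%:R * W)) + 1.
have D0 : 0 < D by rewrite ltr_wpDl// !mulr_ge0.
exists (Order.min e1 D^-1); first by rewrite lt_min e10 invr_gt0.
set e := Order.min _ _.
have e0 : 0 < e by rewrite lt_min e10 invr_gt0.
have ee1 : e <= e1 by rewrite ge_min lexx.
have e1' : e <= 1 by exact: le_trans ee1 _.
have eD : e * D <= 1 by rewrite -ler_pdivlMr// mul1r ge_min lexx orbT.
move=> u' tau' cl.
pose E : 'M[R]_m := \matrix_(j, i) (if i \in J then dot (w j) (u' i - u i) else 0).
pose beta : 'rV[R]_m := \row_i (if i \in J then tau' i - dot x (u' i) else 0).
have [|||s sb sE] := @near_identity_solve R m E (d%:R * W * e) (e * (1 + d%:R * `|x|)) beta.
- move=> j i; rewrite mxE; case: ifP => _; last by rewrite normr0 !mulr_ge0// ltW.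
  apply: (le_trans (dot_norm _ _)); rewrite ler_pM ?mulr_ge0// ?ler_wpM2l//.
  by have [/ltW] := cl i.
- by rewrite /D in eD; move: eD; nra.
- apply: norm_le_coord => [|i].
    by rewrite mulr_ge0 ?ltW// ltr_wpDr// mulr_ge0.
  rewrite mxE; case: ifP => iJ; last first.
    by rewrite normr0 mulr_ge0 ?ltW// ltr_wpDr// mulr_ge0.
  have := close_to_dot x i cl.
  have /tightP -> : i \in tight u tau x by rewrite xJ.
  by rewrite subrr subr0 distrC => /ltW.
pose y := x + \sum_j s ord0 j *: w j.
have yx : `|y - x| <= e * c1.
  rewrite /y addrAC subrr add0r (le_trans (ler_norm_sum _ _ _))//.
  apply: (@le_trans _ _ (\sum_j `|s| * `|w j|)).
    by apply: ler_sum => j _; rewrite normrZ ler_wpM2r ?coord_norm.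
  rewrite -mulr_sumr -/W /c1; apply: (le_trans (ler_wpM2r W0 sb)).
  by rewrite le_eqVlt; apply/orP; left; apply/eqP; ring.
have yn : `|y| <= c2.
  rewrite -(subrK x y) addrC (le_trans (ler_normD _ _))// lerD2l (le_trans yx)//.
  by rewrite ler_piMl.
have yJ i : i \in J -> dot y (u' i) = tau' i.
  move=> iJ; move/rowP/(_ i): sE; rewrite !mxE iJ => /(canRL (addrK _)) sE.
  rewrite /y dotDl dot_suml.
  rewrite (eq_bigr (fun j => s ord0 j * (i == j)%:R + s ord0 j * E j i)); last first.
    move=> j _; rewrite dotZl -mulrDr mxE iJ dotBr; congr (_ * _).
    by have [_ /(_ _ iJ) ->] := wP j; rewrite addrC subrK.
  rewrite big_split/= (bigD1 i)//= eqxx mulr1 big1 => [|j ji].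
    by rewrite addr0 sE; ring.
  by rewrite eq_sym (negbTE ji) mulr0.
have ynJ i : i \notin J -> dot y (u' i) < tau' i.
  move=> iJ; have := close_to_dot y i cl; rewrite ltr_norml => /andP[_].
  have h1 : dot y (u i) <= dot x (u i) + d%:R * (e * c1) * U.
    rewrite -lerBlDl -dotBl (le_trans (ler_norm _))// (le_trans (dot_norm _ _))//.
    by rewrite ler_pM ?mulr_ge0// ler_wpM2l.
  have h2 : e * (1 + d%:R * `|y|) <= e * (1 + d%:R * c2).
    by rewrite ler_pM2l// lerD2l ler_wpM2l.
  have U0 : 0 <= U by exact: sumr_ge0.
  have c20 : 0 <= c2 by rewrite addr_ge0.
  have h3 : e * (d%:R * c1 * U + (1 + d%:R * c2)) < tau i - dot x (u i).
    apply: le_lt_trans (e1P i iJ); rewrite ler_wpM2r// !addr_ge0// ?mulr_ge0//.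
  lra.
exists y; first by move=> i; have [/yJ ->|/ynJ/ltW] := boolP (i \in J).
apply/setP => i; apply/tightP/idP => [h|/yJ//].
by apply: contraT => /ynJ; rewrite h ltxx.
Qed.

(** Having tight set exactly [J] is not a closed condition, which would defeat compactness. By
    [tight_family_sub] it suffices to exclude points whose tight set contains [J], and that
    condition is closed. *)
Lemma tight_family_new (J : {set 'I_m}) M : 0 <= M -> ~ tight_family u tau J ->
  exists2 e, 0 < e & forall u' tau', close_to e u' tau' ->
    (forall x, hpoly u' tau' x -> `|x| <= M) -> ~ tight_family u' tau' J.
Proof.
move=> M0 nJ.
pose h i (x : V) := dot x (u i) - tau i.
(* g measures by how much x fails to be a point of P at which all of J is
   tight; it is positive, hence bounded below on the ball of radius M. *)
pose g (x : V) := \sum_i Order.max 0 (h i x) + \sum_(i in J) `|h i x|.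
have hc i : continuous (h i).
  move=> x; apply: (@continuousB _ _ _ (fun x => dot x (u i)) (cst (tau i))).
    exact: continuous_dot.
  exact: cst_continuous.
have gc : continuous g.
  have c1 : continuous (fun x : V => \sum_i Order.max 0 (h i x)).
    apply: (@continuous_big _ _ _ _ _ _ _ _ (fun i (x : V) => Order.max 0 (h i x))).
      exact: add_continuous.
    move=> i _ x; apply: (@continuous_max R V (cst 0) (h i)); last exact: hc.
    exact: cst_continuous.
  have c2 : continuous (fun x : V => \sum_(i in J) `|h i x|).
    apply: (@continuous_big _ _ _ _ _ _ _ _ (fun i (x : V) => `|h i x|)).
      exact: add_continuous.
    move=> i _ x; apply: (@continuous_comp _ _ _ (h i) Num.norm); first exact: hc.
    exact: norm_continuous.
  by move=> x; apply: continuousD; [exact: c1|exact: c2].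
pose B := [set x : V | `|x| <= M].
have cB : compact B.
  apply: bounded_closed_compact.
    by exists M; split=> [|r Mr x /= xM]; rewrite ?num_real// (le_trans xM)// ltW.
  apply: (@preimage_closed V R (fun x : V => `|x|) [set r | r <= M]).
    by move=> x _; exact: norm_continuous.
  exact: closed_le.
have B0 : B !=set0 by exists 0; rewrite /B/= normr0.
have [c _ cmin] := @EVT_min_rV R d g B B0 cB
  (continuous_subspaceT gc).
have gpos x : 0 < g x.
  have g1 : 0 <= \sum_i Order.max 0 (h i x) by apply: sumr_ge0 => i _; rewrite le_max lexx.
  have g2 : 0 <= \sum_(i in J) `|h i x| by exact: sumr_ge0.
  rewrite lt_neqAle addr_ge0// andbT eq_sym paddr_eq0//; apply/negP => /andP[].
  rewrite !psumr_eq0// => [/allP s1 /allP s2|i _]; last by rewrite le_max lexx.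
  apply: nJ; apply: (@tight_family_sub x).
    move=> i; have := s1 i (mem_index_enum i) => /= /eqP e1.
    by rewrite -subr_le0 -/(h i x) -e1 le_max lexx orbT.
  apply/fintype.subsetP => i iJ; apply/tightP/eqP; rewrite -subr_eq0 -normr_eq0.
  by have := s2 i (mem_index_enum i); rewrite iJ.
(* At a perturbed point with tight set [J], each of the at most [2 * m] terms of [g] is at most
   [e * (1 + d * M)], so [g] would be below its minimum [e * D]. *)
pose D := 2 * m%:R * (1 + d%:R * M) + 1.
have D0 : 0 < D by rewrite ltr_wpDl// !mulr_ge0// addr_ge0// mulr_ge0.
exists (g c / D) => [|u' tau' cl bM [x Px xJ]]; first by rewrite divr_gt0.
set e := g c / D in cl.
have e0 : 0 < e by rewrite divr_gt0.
have xM := bM _ Px.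
have he i : `|(dot x (u' i) - tau' i) - h i x| <= e * (1 + d%:R * M).
  apply: (le_trans (ltW (close_to_dot x i cl))).
  by rewrite ler_pM2l// lerD2l ler_wpM2l.
have K0 : 0 <= e * (1 + d%:R * M) by rewrite mulr_ge0 ?ltW// ltr_wpDr// mulr_ge0.
have : g x <= m%:R * (e * (1 + d%:R * M)) + m%:R * (e * (1 + d%:R * M)).
  apply: lerD.
    rewrite mulr_natl -[m in leRHS]card_ord -sumr_const; apply: ler_sum => i _.
    rewrite ge_max K0/=; have := he i; rewrite ler_norml => /andP[+ _].
    by have := Px i; lra.
  apply: (@le_trans _ _ (\sum_(i in J) e * (1 + d%:R * M))).
    apply: ler_sum => i iJ; have := he i.
    have /tightP -> : i \in tight u' tau' x by rewrite xJ.
    by rewrite subrr sub0r normrN.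
  rewrite sumr_const -[_ *+ _]mulr_natl ler_wpM2r// ler_nat -[leqRHS]card_ord.
  exact: max_card.
have : g c <= g x by apply: cmin; exact/mem_set.
have : e * D = g c by rewrite divfK ?gt_eqF.
rewrite /D; nra.
Qed.

Lemma tight_family_stability : exists e M, [/\ 0 < e, 0 <= M &
  forall u' tau', close_to e u' tau' ->
  [/\ forall i, dot x0 (u' i) < tau' i, forall x, hpoly u' tau' x -> `|x| <= M &
      tight_family u tau = tight_family u' tau']].
Proof.
have [e0 [M [e00 M0 e0P]]] := close_strict_bounded.
have /choice[f fP] : forall J, exists e, 0 < e /\ forall u' tau', close_to e u' tau' ->
    (forall x, hpoly u' tau' x -> `|x| <= M) ->
    (tight_family u tau J <-> tight_family u' tau' J).
  move=> J; have [TJ|nTJ] := pselect (tight_family u tau J).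
    by have [e ? eP] := tight_family_persists TJ; exists e; split=> // *; split=> // _; exact: eP.
  have [e ? eP] := tight_family_new M0 nTJ; exists e; split=> // u' tau' cl bM.
  by split=> // h; have := eP _ _ cl bM h.
exists (\big[Order.min/e0]_J f J), M; split=> //.
  by apply: lt_bigmin => // J _; have [] := fP J.
move=> u' tau' cl.
have [s b] := e0P _ _ (close_to_le (bigmin_le_id _ _ _ _) cl).
split=> //; apply/seteqP; split=> J.
  by apply: (proj1 ((fP J).2 _ _ _ b)); apply: close_to_le cl; exact: bigmin_le_cond.
by apply: (proj2 ((fP J).2 _ _ _ b)); apply: close_to_le cl; exact: bigmin_le_cond.
Qed.

End Stability.

Lemma lt_segment (R : realType) (a b c t : R) :
  a < c -> b <= c -> 0 < t -> t <= 1 -> b + t * (a - b) < c.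
Proof. nra. Qed.

(** * Bounded polyhedra as convex hulls and as cells of a tessellation *)

Section BoundedPolyhedra.
Variables (R : realType) (d m : nat).
Local Notation V := 'rV[R]_d.

Lemma convex_hull_vertex k (p : 'I_k -> V) i : convex_hull p (p i).
Proof.
exists (fun j => (j == i)%:R); split=> [j||]; first by rewrite ler0n.
  by rewrite (bigD1 i)//= eqxx big1 ?addr0// => j /negbTE ->.
by rewrite (bigD1 i)//= eqxx scale1r big1 ?addr0// => j /negbTE ->; rewrite scale0r.
Qed.

Lemma convex_hull_segment k (p : 'I_k -> V) x y s t : convex_hull p x ->
  convex_hull p y -> 0 <= s -> 0 <= t -> s + t = 1 -> convex_hull p (s *: x + t *: y).
Proof.
move=> [a [a0 a1 ->]] [b [b0 b1 ->]] s0 t0 st.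
exists (fun i => s * a i + t * b i); split=> [i||].
- by rewrite addr_ge0// mulr_ge0.
- by rewrite big_split/= -!mulr_sumr a1 b1 !mulr1.
rewrite !scaler_sumr -big_split/=; apply: eq_bigr => i _.
by rewrite scalerDl !scalerA.
Qed.

Variables (u : 'I_m -> V) (tau : 'I_m -> R).
Local Notation P := (hpoly u tau).

(** A point with spanning tight normals is determined by its tight set, so indexing by the subsets
    of ['I_m] lists all of these, with [x0] as filler. Any other point is pushed along [w] and [- w]
    until more inequalities are tight, and lies between the two resulting points. *)
Lemma bounded_hpoly_polytope : norm_bounded P -> P !=set0 -> polytope P.
Proof.
move=> bP [x0 Px0].
have /choice[v vP] : forall J : {set 'I_m}, exists v, P v /\
    forall x, P x -> normals_span u (tight u tau x) -> tight u tau x = J -> v = x.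
  move=> J; have [[x [Px sx xJ]]|h] := pselect (exists x, [/\ P x,
      normals_span u (tight u tau x) & tight u tau x = J]).
    exists x; split=> // y Py sy yJ; apply/eqP; rewrite -subr_eq0; apply/eqP/sx => i ix.
    rewrite dotBl (tightP _ _ _ _ ix).
    by rewrite xJ -yJ in ix; rewrite (tightP _ _ _ _ ix) subrr.
  by exists x0; split=> // x Px sx xJ; exfalso; apply: h; exists x.
pose p (k : 'I_#|{: {set 'I_m}}|) := v (enum_val k).
exists #|{: {set 'I_m}}|, p; apply/seteqP; split; last first.
  move=> _ [a [a0 a1 ->]] i; rewrite dot_suml -[leRHS]mul1r -a1 mulr_suml.
  by apply: ler_sum => k _; rewrite dotZl ler_wpM2l//; have [] := vP (enum_val k).
move=> x Px; have [n] := ubnP (m - #|tight u tau x|); elim: n x Px => // n IH x Px xn.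
have [sx|] := pselect (normals_span u (tight u tau x)).
  have [_ /(_ _ Px sx erefl) <-] := vP (tight u tau x).
  rewrite -[v _]/(v (tight u tau x)) -(enum_rankK (tight u tau x)).
  exact: (convex_hull_vertex p).
move=> /existsNP[w /not_implyP[xw /eqP w0]].
have IH' t : P (x + t *: w) -> tight u tau x \proper tight u tau (x + t *: w) ->
    convex_hull p (x + t *: w).
  move=> Pt /proper_card xt; apply: IH => //.
  have : (#|tight u tau (x + t *: w)| <= m)%N by rewrite -[leqRHS]card_ord max_card.
  move: xt xn; lia.
have [t [t0 Pt /(IH' _ Pt) ht]] := push bP Px w0 xw.
have [|i ix|s [s0]] := push (w := - w) bP Px; first by rewrite oppr_eq0.
  by rewrite dotNl xw// oppr0.
rewrite scalerN -scaleNr => Ps /(IH' _ Ps) hs.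
have ts : 0 < s + t by rewrite addr_gt0.
have -> : x = (s / (s + t)) *: (x + t *: w) + (t / (s + t)) *: (x + - s *: w).
  rewrite !scalerDr addrACA -scalerDl -mulrDl divff ?gt_eqF// scale1r !scalerA.
  by rewrite -scalerDl mulrN mulrAC [t / _ * s]mulrAC [t * s]mulrC subrr scale0r addr0.
apply: convex_hull_segment => //; first by rewrite divr_ge0 ?ltW.
  by rewrite divr_ge0 ?ltW.
by rewrite -mulrDl divff ?gt_eqF.
Qed.

Lemma closed_hpoly : closed P.
Proof.
rewrite (_ : P = \bigcap_i [set x | dot x (u i) <= tau i]); last first.
  by apply/seteqP; split=> [x Px i _|x Px i]; exact: Px.
apply: closed_bigI => i _.
apply: (@preimage_closed V R (fun x : V => dot x (u i)) [set r | r <= tau i]).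
  by move=> x _; exact: continuous_dot.
exact: closed_le.
Qed.

Definition open_hpoly : set V := [set x | forall i, dot x (u i) < tau i].

Lemma closure_open_hpoly x0 : open_hpoly x0 -> closure open_hpoly = P.
Proof.
move=> x0P; apply/seteqP; split.
  rewrite [X in _ `<=` X](closure_id P).1; last exact: closed_hpoly.
  by apply: closureS => x xP i; exact: ltW.
move=> y Py B /nbhs_ballP[e /= e0 eB].
have [t [t0 t1 tP]] := @small_step R unit xpredT (fun=> `|x0 - y|) (fun=> e) (fun _ _ => e0).
exists (y + t *: (x0 - y)); split.
  move=> i; rewrite dotDl dotZl dotBl; exact: lt_segment (x0P i) (Py i) t0 t1.
apply: eB; rewrite -ball_normE /ball_/= opprD addrA subrr add0r normrN normrZ gtr0_norm//.
exact: (tP tt).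
Qed.

Lemma segment_connected_hpoly x0 y : open_hpoly x0 -> open_hpoly y ->
  exists C, [/\ connected C, C x0, C y & C `<=` open_hpoly].
Proof.
move=> x0P yP; exists ((fun t : R => x0 + t *: (y - x0)) @` `[0, 1]); split.
- apply: connected_continuous_connected; first exact: segment_connected.
  apply: continuous_subspaceT => t; apply: cvgD; first exact: cvg_cst.
  by apply: cvgZr_tmp; exact: cvg_id.
- by exists 0; rewrite ?scale0r ?addr0//= in_itv/= lexx ler01.
- by exists 1; rewrite ?scale1r 1?addrC ?subrK//= in_itv/= lexx ler01.
move=> _ [t /= + <-] i; rewrite in_itv/= => /andP[t0 t1].
rewrite dotDl dotZl dotBl; have [t0'|] := ltP 0 t.
  exact: lt_segment (yP i) (ltW (x0P i)) t0' t1.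
by move=> t0'; rewrite (@le_anti _ _ t 0) ?mul0r ?addr0 ?t0 ?t0'//; exact: x0P.
Qed.

(** The open polyhedron is convex and meets no hyperplane of [S]. A connected set that leaves it has
    to cross a bounding hyperplane, by the intermediate value property of [dot x (u i)]. *)
Lemma induced_tessellation_cell (S : set (set V)) x0 : open_hpoly x0 ->
  (forall i, S (hyperplane (u i) (tau i))) ->
  (forall H, S H -> H `&` P !=set0 -> exists i, H = hyperplane (u i) (tau i)) ->
  induced_tessellation S P.
Proof.
move=> x0P uS SP.
pose D : set V := ~` \bigcup_(H in S) H.
have sub : open_hpoly `<=` D.
  move=> x xP [H SH Hx].
  have [|i HE] := SP H SH; first by exists x; split=> // i; exact: ltW.
  by move: Hx; rewrite HE /hyperplane/= => xi; have := xP i; rewrite xi ltxx.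
exists x0; first exact: sub.
rewrite -(closure_open_hpoly x0P); congr closure; apply/seteqP; split.
  move=> y [A [Ax0 AD cA] Ay] i.
  rewrite ltNge; apply/negP => yi.
  have /connected_intervalP iA : connected ((fun x : V => dot x (u i)) @` A).
    apply: connected_continuous_connected => //.
    by apply: continuous_subspaceT => x; exact: continuous_dot.
  have [|||x Ax xi] := iA (dot x0 (u i)) (dot y (u i)) _ _ (tau i).
  - by exists x0.
  - by exists y.
  - by rewrite ltW//; exact: x0P.
  by apply: (AD _ Ax); exists (hyperplane (u i) (tau i)).
move=> y yP; have [C [cC Cx Cy CP]] := segment_connected_hpoly x0P yP.
by exists C => //; split=> // z /CP/sub.
Qed.

End BoundedPolyhedra.

(** * The space of hyperplanes *)

Section HyperplaneSpace.
Variables (R : realType) (d : nat).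
Local Notation V := 'rV[R]_d.

(** The points [s *: u + w] with [w] orthogonal to [u] lie in both hyperplanes. Testing [w = 0] and
    [w = v - dot u v *: u] gives [t = s * dot u v] and [dot u v ^+ 2 = 1]. *)
Lemma hyperplane_inj (u v : V) s t : sphere u -> sphere v ->
  hyperplane u s = hyperplane v t -> (v = u /\ t = s) \/ (v = - u /\ t = - s).
Proof.
move=> /sphereE u1 /sphereE v1 H.
have on w : dot w u = 0 -> s * dot u v + dot w v = t.
  move=> wu; have : hyperplane u s (s *: u + w).
    by rewrite /hyperplane/= dotDl dotZl u1 wu mulr1 addr0.
  by rewrite H /hyperplane/= dotDl dotZl.
have t_eq := on 0 (dot0l _); rewrite dot0l addr0 in t_eq.
set c := dot u v in t_eq on *.
have w0 : dot (v - c *: u) u = 0 by rewrite dotBl dotZl u1 mulr1 dotC subrr.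
have c1 : c ^+ 2 = 1.
  have := on _ w0; rewrite t_eq dotBl dotZl v1 -/c -expr2 => /eqP.
  by rewrite -subr_eq0 addrAC subrr add0r subr_eq0 => /eqP.
have vcu : v = c *: u.
  apply/eqP; rewrite -subr_eq0 -dot_eq0 dotBr dotZr w0 mulr0 subr0 dotBl dotZl.
  by rewrite v1 -/c -expr2 c1 subrr.
have /eqP := c1; rewrite sqrf_eq1 => /orP[]/eqP ce; [left|right].
  by rewrite vcu -t_eq ce scale1r mulr1.
by rewrite vcu -t_eq ce scaleN1r mulrN1.
Qed.

Definition hyperplanes_in (O : set (V * R)%type) : set (set V) :=
  [set H | exists u tau, [/\ sphere u, H = hyperplane u tau & O (u, tau)]].

Lemma hyperplanes_inE O u tau : sphere u ->
  hyperplanes_in O (hyperplane u tau) <-> O (u, tau) \/ O (- u, - tau).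
Proof.
move=> su; have sNu : sphere (- u) by apply/sphereE; rewrite dotNl dotNr opprK; exact/sphereE.
split=> [[v [t [sv e Ovt]]]|[Out|Out]].
- by have [[<- <-]|[<- <-]] := hyperplane_inj su sv e; [left|right].
- by exists u, tau.
exists (- u), (- tau); split=> //; apply/seteqP.
by split=> x; rewrite /hyperplane/= dotNr; [move=> ->|exact: oppr_inj].
Qed.

(** [O] may be asymmetric; the preimage in the space of pairs is the union of [O] with its
    reflection, which is open. *)
Lemma hopen_hyperplanes_in O : open O -> hopen (hyperplanes_in O).
Proof.
move=> oO; split=> [_ [u [t [su -> _]]]|]; first by exists u, t.
exists (O `|` [set p | O (- p.1, - p.2)]); split; last first.
  by move=> u t su; rewrite hyperplanes_inE.
apply: openU => //.
apply: (@open_comp _ _ (-%R : V * R -> V * R)) => // p _.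
exact: opp_continuous.
Qed.

Lemma sub_hborel (A : set (set V)) : hopen A -> hborel A.
Proof. exact: sub_sigma_algebra. Qed.

Lemma hborel_subset (A : set (set V)) : hborel A -> A `<=` @hyperplanes R d.
Proof.
apply: (@smallest_sub _ (sigma_algebra _) _ (fun A => A `<=` @hyperplanes R d)).
  split=> [//|B _ H []//|F FH H [k _]]; exact: FH.
by move=> B [].
Qed.

Lemma hborelI (A B : set (set V)) : hborel A -> hborel B -> hborel (A `&` B).
Proof.
have /sigma_algebraP := smallest_sigma_algebra (@hyperplanes R d) (@hopen R d).
by move=> /(_ hborel_subset)[_ _ _]; exact.
Qed.

Lemma hborelD (A B : set (set V)) : hborel A -> hborel B -> hborel (A `\` B).
Proof.
move=> mA mB; rewrite (_ : A `\` B = A `&` (@hyperplanes R d `\` B)).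
  by apply: hborelI => //; exact: sigma_algebraCD.
by apply/seteqP; split=> H [AH]; [split=> //; split=> //; exact: hborel_subset AH|case].
Qed.

Lemma hborel_bigcup m (A : 'I_m -> set (set V)) : (forall i, hborel (A i)) ->
  hborel (\bigcup_i A i).
Proof.
move=> mA; pose F k := if insub k is Some i then A i else set0.
rewrite (_ : \bigcup_i A i = \bigcup_k F k).
  by apply: sigma_algebra_bigcup => k; rewrite /F; case: insub => // ; exact: sigma_algebra0.
apply/seteqP; split=> [H [i _ AH]|H [k _]]; last by rewrite /F; case: insubP => // i _ _ AH; exists i.
by exists i => //; rewrite /F valK.
Qed.

(** [|dot z u - tau|] is the Euclidean distance from [z] to [H(u, tau)], so these hyperplanes meet
    the open Euclidean ball of radius [r] about [z]. *)
Definition hitting (z : V) (r : R) : set (set V) :=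
  hyperplanes_in [set p | `|dot z p.1 - p.2| < r].

(** A neighbourhood of [H(a, b)] translated by [z]. The centre [a] may be off the sphere, so that it
    can be taken rational. *)
Definition near_hyperplane (z a : V) (b e : R) : set (set V) :=
  hyperplanes_in ([set p | `|p.1 - a| < e] `&` [set p | `|p.2 - dot z p.1 - b| < e]).

Lemma continuous_dot_fst (z : V) : continuous (fun p : V * R => dot z p.1).
Proof.
rewrite (_ : (fun _ => _) = (fun x : V => dot x z) \o fst); last first.
  by apply/funext => p /=; rewrite dotC.
move=> p; apply: continuous_comp; first exact: cvg_fst.
exact: continuous_dot.
Qed.

Lemma open_norm_lt (T : topologicalType) (W : normedModType R) (f : T -> W) r :
  continuous f -> open [set p | `|f p| < r].
Proof.
move=> cf; apply: (@open_comp _ _ (fun p => `|f p|) [set x | x < r]); last exact: open_lt.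
move=> p _; apply: (@continuous_comp _ _ _ f Num.norm); first exact: cf.
exact: norm_continuous.
Qed.

Lemma hopen_hitting z r : hopen (hitting z r).
Proof.
apply: hopen_hyperplanes_in; apply: (@open_norm_lt _ R^o) => p.
apply: (@continuousB _ R^o _ (fun p : V * R => dot z p.1) (snd : V * R -> R)).
  exact: continuous_dot_fst.
exact: cvg_snd.
Qed.

Lemma hopen_near_hyperplane z a b e : hopen (near_hyperplane z a b e).
Proof.
apply: hopen_hyperplanes_in; apply: openI.
  apply: (@open_norm_lt _ V (fun p : V * R => p.1 - a)) => p.
  apply: (@continuousB _ V _ (fst : V * R -> V) (cst a)); first exact: cvg_fst.
  exact: cst_continuous.
apply: (@open_norm_lt _ R^o (fun p : V * R => p.2 - dot z p.1 - b)) => p.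
apply: (@continuousB _ R^o _ (fun p : V * R => p.2 - dot z p.1) (cst b)); last exact: cst_continuous.
apply: (@continuousB _ R^o _ (snd : V * R -> R) (fun p : V * R => dot z p.1)).
  exact: cvg_snd.
exact: continuous_dot_fst.
Qed.

Lemma hittingE z r u tau : sphere u -> hitting z r (hyperplane u tau) <-> `|dot z u - tau| < r.
Proof.
move=> su; rewrite /hitting hyperplanes_inE//= dotNr.
by rewrite -(normrN (_ - - tau)) opprD !opprK; tauto.
Qed.

Lemma meets_ball_hitting (z x : V) r (H : set V) : hyperplanes H -> H x -> enorm (x - z) < r ->
  hitting z r H.
Proof.
move=> [u [tau [su ->]]]; rewrite /hyperplane/= => xu xz; apply/hittingE => //.
rewrite -xu -dotBl; apply: le_lt_trans xz.
rewrite -normrN -dotNl opprB -sqrtr_sqr ler_sqrt ?dot_ge0//.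
exact: dot_unit_sqr.
Qed.

Lemma translate_hyperplane (z u : V) tau :
  translate z (hyperplane u tau) = hyperplane u (tau + dot z u).
Proof.
apply/seteqP; split=> [_ [x /= <- <-]|x /= xu]; first by rewrite /hyperplane/= dotDl.
by exists (x - z); rewrite ?subrK// /hyperplane/= dotBl xu addrK.
Qed.

Lemma translateK (z : V) : cancel (@translate R d z) (translate (- z)).
Proof.
move=> H; rewrite /translate image_comp (_ : _ \o _ = id) ?image_id//.
by apply/funext => x /=; rewrite addrK.
Qed.

Lemma translateNK (z : V) : cancel (@translate R d (- z)) (translate z).
Proof. by move=> H; rewrite -{1}[z]opprK translateK. Qed.

Lemma translate_hitting z r H : hitting 0 r (translate (- z) H) <-> hitting z r H.
Proof.
split=> [[u [t [su HE /= h]]]|[u [t [su -> /= h]]]].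
  rewrite -[H](translateNK z) HE translate_hyperplane hittingE//.
  by move: h; rewrite dot0l; congr (`|_| < _); ring.
by rewrite translate_hyperplane hittingE// dot0l dotNl; move: h; congr (`|_| < _); ring.
Qed.

Lemma translate_near z a b e H :
  near_hyperplane 0 a b e (translate (- z) H) <-> near_hyperplane z a b e H.
Proof.
split=> [[u [t [su HE /= [h1 h2]]]]|[u [t [su -> /= [h1 h2]]]]].
  rewrite -[H](translateNK z) HE translate_hyperplane.
  exists u, (t + dot z u); split=> //; split=> //=.
  by move: h2; rewrite dot0l subr0 addrK.
rewrite translate_hyperplane; exists u, (t + dot (- z) u); split=> //; split=> //=.
by rewrite dot0l subr0 dotNl.
Qed.

Lemma npoints_translate (z : V) (S A B : set (set V)) :
  (forall H, A (translate (- z) H) <-> B H) ->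
  npoints (translate (- z) @` S) A = npoints S B :> \bar R.
Proof.
move=> AB; rewrite /npoints (_ : _ `&` A = translate (- z) @` (S `&` B)); last first.
  apply/seteqP; split=> [_ [[H SH <-] /AB BH]|_ [H [SH /AB AH] <-]]; first by exists H.
  by split=> //; exists H.
have inj : injective (@translate R d (- z)) by exact: can_inj (translateNK z).
have card_im := @inj_card_eq _ _ (S `&` B) (translate (- z)) (in2W inj).
rewrite /counting (eq_finite_set card_im); case: asboolP => // /finite_setP[n Sn].
by rewrite (card_fset_set Sn) (card_fset_set (card_eq_trans card_im Sn)).
Qed.

(** The two conditions answer to the two representations [(u, tau)] and [(- u, - tau)] of a common
    hyperplane. *)
Lemma near_hyperplane_disjoint (a a' : V) b b' e z :
  ~ (`|a - a'| < 2 * e /\ `|b - b'| < 2 * e) ->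
  ~ (`|a + a'| < 2 * e /\ `|b + b'| < 2 * e) ->
  near_hyperplane z a b e `&` near_hyperplane z a' b' e = set0.
Proof.
move=> h1 h2; apply/seteqP; split=> // H [[u [s [su -> /= [ua sb]]]] [v [t [sv e' /= [va tb]]]]].
have dist (W : normedModType R) (x y y' : W) : `|x - y| < e -> `|x - y'| < e ->
    `|y - y'| < 2 * e.
  move=> xy xy'; have := ler_normB (x - y') (x - y).
  by rewrite opprB addrC addrA subrK; move: xy xy'; lra.
have [[vu ts]|[vu ts]] := hyperplane_inj su sv e'; subst v t.
  by apply: h1; split; [exact: dist ua va|exact: (@dist R^o) sb tb].
apply: h2; split.
  by rewrite -[a']opprK; apply: dist ua _; rewrite opprK -normrN opprD.
rewrite -[b']opprK; apply: (@dist R^o _ _ _ sb).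
by move: tb; rewrite dotNr -normrN; congr (`|_| < _); ring.
Qed.

End HyperplaneSpace.

(** * Second moments of the point process *)

Section NonnegIntegral.
Local Open Scope ereal_scope.
Context {dT : measure_display} {T : measurableType dT} {R : realType}.
Variable mu : {measure set T -> \bar R}.

(* No measurability is needed, since the integral of a nonnegative function is
   a supremum over the simple functions below it. *)
Lemma ge0_integral_mono (D : set T) (f g : T -> \bar R) :
  (forall x, D x -> 0 <= f x) -> (forall x, D x -> f x <= g x) ->
  \int[mu]_(x in D) f x <= \int[mu]_(x in D) g x.
Proof.
move=> f0 fg; rewrite !ge0_integralE//; last by move=> x Dx; exact: le_trans (f0 x Dx) (fg x Dx).
apply: ereal_sup_le => _ [h /= hf <-]; exists h => // x /=; apply: le_trans (hf x) _; rewrite /patch; case: ifPn => // /set_mem.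
exact: fg.
Qed.

End NonnegIntegral.

Section SecondMoment.
Local Open Scope ereal_scope.
Context {dT : measure_display} {Omega : measurableType dT} {R : realType}.
Variables (P : probability Omega R) (T : finType) (E : T -> set Omega).
Variables (p : R) (q : T -> T -> R).
Hypothesis mE : forall t, measurable (E t).
Hypothesis PE : forall t, P (E t) = p%:E.
Hypothesis PEE : forall t t', P (E t `&` E t') <= (p ^+ 2 + q t t')%:E.

Definition occurrences (w : Omega) : R := (\sum_t \1_(E t) w)%R.

Lemma measurable_occurrences : measurable_fun setT occurrences.
Proof. by apply: measurable_sum => t; exact: measurable_indic. Qed.

(** Chebyshev's inequality at half of the mean: the deviation is at least [p * #|T| / 2], whence the
    factor 4. *)
Lemma few_occurrences : (0 < p)%R -> (0 < #|T|)%N ->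
  P [set w | (occurrences w <= p * #|T|%:R / 2)%R] <=
  (4 * (\sum_t \sum_t' q t t') / (p * #|T|%:R) ^+ 2)%:E.
Proof.
move=> p0 T0; set M : R := #|T|%:R; have M0 : (0 < M)%R by rewrite ltr0n.
set B := [set w | _].
have mB : measurable B.
  rewrite /B -[X in measurable X]setTI; apply: measurable_fun_le => //.
  exact: measurable_occurrences.
pose c : R := ((p * M / 2) ^+ 2)%R.
have c0 : (0 < c)%R by rewrite exprn_gt0// divr_gt0// mulr_gt0.
have indicI t t' w : (\1_(E t) w * \1_(E t') w = \1_(E t `&` E t') w :> R)%R.
  by rewrite indicI.
have sumE w : (\sum_t \sum_t' \1_(E t `&` E t') w = occurrences w ^+ 2 :> R)%R.
  rewrite expr2 /occurrences mulr_suml; apply: eq_bigr => t _.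
  by rewrite mulr_sumr; apply: eq_bigr => t' _.
(* Integrating this instead of (occurrences - p M)^2 keeps both sides
   nonnegative. *)
have ptw w : (c * \1_B w + 2 * p * M * occurrences w <=
    occurrences w ^+ 2 + (p * M) ^+ 2)%R.
  rewrite indicE; case: (boolP (w \in B)) => [/set_mem|_]; last first.
    by rewrite mulr0 add0r; have := sqr_ge0 (occurrences w - p * M)%R; nra.
  rewrite /B/= mulr1 /c; set a := (p * M)%R => wB.
  have a0 : (0 < a)%R by exact: mulr_gt0.
  rewrite -[(2 * p * M)%R]mulrA -/a; nra.
have mI (A : set Omega) : measurable A -> measurable_fun setT (EFin \o (\1_A : Omega -> R)).
  by move=> mA; apply/measurable_EFinP; exact: measurable_indic.
have intI A : measurable A -> \int[P]_w (\1_A w)%:E = P A.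
  by move=> mA; rewrite integral_indic// setIT.
have occ0 w : (0 <= occurrences w)%R by exact: sumr_ge0.
have pM0 : (0 <= 2 * p * M)%R by rewrite !mulr_ge0// ltW.
have intL : \int[P]_w (c * \1_B w + 2 * p * M * occurrences w)%:E =
    c%:E * P B + (2 * p * M * (M * p))%:E.
  under eq_integral do rewrite EFinD.
  rewrite ge0_integralD//; [|by move=> w _; rewrite lee_fin mulr_ge0// ltW|
    by apply/measurable_EFinP; apply: measurable_funM => //; exact: measurable_indic|
    by move=> w _; rewrite lee_fin mulr_ge0|
    by apply/measurable_EFinP; apply: measurable_funM => //; exact: measurable_occurrences].
  congr (_ + _).
    under eq_integral do rewrite EFinM.
    by rewrite ge0_integralZl_EFin// ?intI ?ltW//; exact: mI.
  under eq_integral do rewrite EFinM.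
  rewrite ge0_integralZl_EFin//; [|by move=> w _; rewrite lee_fin|
    by apply/measurable_EFinP; exact: measurable_occurrences].
  rewrite [X in _ * X](_ : _ = (M * p)%:E) -?EFinM//.
  under eq_integral do rewrite /occurrences -sumEFin.
  rewrite ge0_integral_sum//; last by move=> t; exact: mI.
  rewrite (eq_bigr (fun=> p%:E)) => [|t _]; last by rewrite intI.
  by rewrite sumEFin sumr_const mulr_natl.
have intR : \int[P]_w (occurrences w ^+ 2 + (p * M) ^+ 2)%:E =
    \sum_t \sum_t' P (E t `&` E t') + ((p * M) ^+ 2)%:E.
  under eq_integral do rewrite -sumE EFinD.
  rewrite ge0_integralD//; [|by move=> w _; rewrite lee_fin sumr_ge0// => t _; rewrite sumr_ge0|
    |by move=> w _; rewrite lee_fin sqr_ge0].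
    rewrite integral_cst//= [P setT]probability_setT mule1; congr (_ + _).
    under eq_integral do rewrite -sumEFin.
    rewrite ge0_integral_sum//.
    - apply: eq_bigr => t _; under eq_integral do rewrite -sumEFin.
      rewrite ge0_integral_sum//; first by apply: eq_bigr => t' _; rewrite intI//; exact: measurableI.
      by move=> t'; apply: mI; exact: measurableI.
    - move=> t; apply/measurable_EFinP; apply: measurable_sum => t'.
      by apply: measurable_indic; exact: measurableI.
    - by move=> t w _; rewrite lee_fin sumr_ge0.
  apply/measurable_EFinP; apply: measurable_sum => t; apply: measurable_sum => t'.
  by apply: measurable_indic; exact: measurableI.
have : c%:E * P B + (2 * p * M * (M * p))%:E <=
    \sum_t \sum_t' (p ^+ 2 + q t t')%:E + ((p * M) ^+ 2)%:E.
  rewrite -intL; apply: (@le_trans _ _ (\int[P]_w (occurrences w ^+ 2 + (p * M) ^+ 2)%:E)).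
    apply: ge0_integral_mono => w _; rewrite lee_fin//.
    by rewrite addr_ge0// mulr_ge0// ltW.
  by rewrite intR leeD2r//; apply: lee_sum => t _; exact: lee_sum.
have -> : \sum_t \sum_t' (p ^+ 2 + q t t')%:E = (p ^+ 2 * M ^+ 2 + \sum_t \sum_t' q t t')%:E.
  rewrite (eq_bigr (fun t => (p ^+ 2 * M + \sum_t' q t t')%:E)) => [|t _].
    rewrite sumEFin big_split/= sumr_const -[(_ *+ _)%R]mulr_natr -/M.
    by congr (_ + _)%:E; ring.
  by rewrite sumEFin big_split/= sumr_const -[(_ *+ _)%R]mulr_natr.
have PB : P B \is a fin_num by exact: fin_num_measure.
rewrite -(fineK PB) -EFinM -!EFinD !lee_fin => h.
rewrite ler_pdivlMr ?exprn_gt0 ?mulr_gt0//.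
move: h; rewrite /c; nra.
Qed.

End SecondMoment.

Lemma sum_nat_count (T : Type) (a : pred T) (s : seq T) :
  (\sum_(x <- s) a x)%N = count a s.
Proof. by elim: s => [|x s IH]; rewrite ?big_nil ?big_cons//= IH. Qed.

Section CountingPoints.
Variables (R : realType) (d : nat).
Local Notation V := 'rV[R]_d.
Implicit Types S A B : set (set V).
Local Open Scope ereal_scope.

Lemma counting_ge0 (T : choiceType) (A : set T) : 0 <= counting A :> \bar R.
Proof. by rewrite /counting; case: ifPn; rewrite ?lee_fin// leey. Qed.

Lemma counting_subset (T : choiceType) (A B : set T) : A `<=` B ->
  counting A <= counting B :> \bar R.
Proof.
move=> AB; rewrite /counting; have [fB|fB] := asboolP (finite_set B); last exact: leey.
have fA := sub_finite_set AB fB.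
rewrite asboolT// lee_fin ler_nat fsubset_leq_card//.
by apply/fsubsetP => x; rewrite !in_fset_set// !in_setE; exact: AB.
Qed.

Lemma counting_set0 (T : choiceType) (A : set T) : counting A = 0 :> \bar R -> A = set0.
Proof.
rewrite /counting; case: asboolP => // fA [] /eqP.
by rewrite pnatr_eq0 cardfs_eq0 => /eqP /fset_set_set0 ->.
Qed.

Lemma counting_ge1 (T : choiceType) (A : set T) : counting A != 0 :> \bar R ->
  1 <= counting A :> \bar R.
Proof.
rewrite /counting; case: asboolP => // fA; last by rewrite leey.
by rewrite eqe pnatr_eq0 lee_fin ler1n lt0n.
Qed.

Lemma counting_set1 (T : choiceType) (A : set T) : counting A = 1 :> \bar R ->
  exists x, A = [set x].
Proof.
rewrite /counting; case: asboolP => // fA [] /eqP; rewrite pnatr_eq1 => /cardfs1P[x Ax].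
by exists x; rewrite -[A]fset_setK// Ax; apply/seteqP; split=> y /=; rewrite in_fset1 => /eqP.
Qed.

Lemma npoints_mono S A B : A `<=` B -> npoints S A <= npoints S B :> \bar R.
Proof. by move=> AB; apply: counting_subset; exact: setIS. Qed.

(** Double counting of the pairs of a point and an index. If [A] contains infinitely many points,
    the right side is [+oo] because [C] is positive. *)
Lemma sum_npoints_le (I : finType) (S A : set (set V)) (B : I -> set (set V)) (C : nat) :
  (0 < C)%N -> (forall H, S H -> A H -> (#|[pred i | `[< B i H >]]| <= C)%N) ->
  \sum_i npoints S (A `&` B i) <= C%:R%:E * npoints S A :> \bar R.
Proof.
move=> C0 hC; rewrite /npoints; have [fA|iA] := pselect (finite_set (S `&` A)); last first.
  by rewrite [X in _ <= _ * X]/counting asboolF// mulry gtr0_sg ?ltr0n// mul1e leey.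
pose F := fset_set (S `&` A).
have cB i : counting (S `&` (A `&` B i)) =
    (\sum_(H <- enum_fset F) `[< B i H >])%N%:R%:E :> \bar R.
  have fB : finite_set (S `&` (A `&` B i)).
    by apply: sub_finite_set fA => H [SH [AH _]].
  rewrite /counting asboolT//; congr (_%:R%:E).
  rewrite sum_nat_count -size_filter; apply/perm_size/uniq_perm.
  - exact: fset_uniq.
  - by rewrite filter_uniq// fset_uniq.
  move=> H; rewrite mem_filter !in_fset_set//; apply/idP/andP.
    by move=> /set_mem[SH [AH BH]]; split; [exact/asboolP|exact/mem_set].
  by move=> [/asboolP BH /set_mem[SH AH]]; exact/mem_set.
rewrite (eq_bigr _ (fun i _ => cB i)) sumEFin -natr_sum /counting asboolT// -EFinM lee_fin.
rewrite -natrM ler_nat exchange_big/= -sum1_size mulnC big_distrl/= big_seq [leqRHS]big_seq.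
apply: leq_sum => H; rewrite in_fset_set// in_setE => -[SH AH].
by rewrite mul1n (leq_trans _ (hC H SH AH))// -sum1_card [leqRHS]big_mkcond/=; apply: leq_sum => i _.
Qed.

End CountingPoints.

Section PointProcess.
Local Open Scope ereal_scope.
Context {disp : measure_display} {Omega : measurableType disp} {R : realType}.
Variables (d : nat) (P : probability Omega R) (X : Omega -> set (set 'rV[R]_d)).
Local Notation V := 'rV[R]_d.
Hypothesis hX : hyperplane_process X.
Hypothesis indX : independent_on_disjoint P X.

Definition count_event m (A : 'I_m -> set (set V)) (k : 'I_m -> nat) : set Omega :=
  [set w | forall i, npoints (X w) (A i) = (k i)%:R%:E].

Lemma measurable_npoints (A : set (set V)) (B : set (\bar R)) : hborel A -> measurable B ->
  measurable [set w | B (npoints (X w) A)].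
Proof.
by case: hX => _ _ mX mA mB; have := mX A mA measurableT B mB; rewrite setTI.
Qed.

Lemma measurable_count_event m (A : 'I_m -> set (set V)) k :
  (forall i, hborel (A i)) -> measurable (count_event A k).
Proof.
move=> mA; rewrite (_ : count_event A k =
    \bigcap_(i in [set: 'I_m]) [set w | npoints (X w) (A i) = (k i)%:R%:E]); last first.
  by apply/seteqP; split=> [w h i _|w h i]; exact: h.
by apply: fin_bigcap_measurable => // i _; exact: (@measurable_npoints _ [set _]).
Qed.

Lemma count_event_indep m (A : 'I_m -> set (set V)) k : (forall i, hborel (A i)) ->
  trivIset setT A ->
  P (count_event A k) = \prod_(i < m) P [set w | npoints (X w) (A i) = (k i)%:R%:E].
Proof. by move=> mA tA; apply: (indX (B := fun i => [set (k i)%:R%:E])). Qed.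

(** Markov's inequality: a nonzero count is at least 1. *)
Lemma prob_meets_le W : hborel W ->
  P [set w | npoints (X w) W != 0] <= intensity_measure P X W.
Proof.
move=> mW; have mN : measurable [set w | npoints (X w) W != 0].
  rewrite (_ : [set w | _] = ~` [set w | npoints (X w) W = 0]); last first.
    by apply/seteqP; split=> w /=; move/eqP.
  by apply: measurableC; exact: (@measurable_npoints _ [set _]).
have := integral_indic P measurableT mN; rewrite setIT => <-.
apply: ge0_integral_mono => w _.
  by rewrite lee_fin.
rewrite indicE; case: (boolP (w \in _)) => [/set_mem/= /counting_ge1//|_].
exact: counting_ge0.
Qed.

(* When no point of X lies in K `&` K', the two events depend on X only through
   the disjoint sets K `\` K' and K' `\` K. *)
Lemma covariance_bound m m' (A : 'I_m -> set (set V)) k (A' : 'I_m' -> set (set V)) k' K K' :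
  (forall i, hborel (A i)) -> (forall i, hborel (A' i)) -> hborel K -> hborel K' ->
  trivIset setT A -> trivIset setT A' ->
  (forall i, A i `<=` K) -> (forall i, A' i `<=` K') ->
  P (count_event A k `&` count_event A' k') <=
  P (count_event A k) * P (count_event A' k') +
    4%:E * P [set w | npoints (X w) (K `&` K') != 0].
Proof.
move=> mA mA' mK mK' tA tA' AK AK'.
set W := K `&` K'; have mW : hborel W by exact: hborelI.
set N := [set w | _].
have mN : measurable N.
  rewrite (_ : N = ~` [set w | npoints (X w) W = 0]); last first.
    by apply/seteqP; split=> w /=; move/eqP.
  by apply: measurableC; exact: (@measurable_npoints _ [set _]).
pose B i := A i `\` W; pose B' i := A' i `\` W.
have mB i : hborel (B i) by exact: hborelD.
have mB' i : hborel (B' i) by exact: hborelD.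
have offN w (C : set (set V)) : ~ N w -> npoints (X w) (C `\` W) = npoints (X w) C.
  move=> /negP/negPn/eqP/counting_set0 XW; congr counting; apply/seteqP.
  split=> H [XH]; first by case.
  by move=> CH; split=> //; split=> // WH; have : (X w `&` W) H by []; rewrite XW.
have swap n (C : 'I_n -> set (set V)) l w : ~ N w ->
    count_event (fun i => C i `\` W) l w <-> count_event C l w.
  by move=> nN; split=> h i; have := h i; rewrite offN.
have tsub n (C : 'I_n -> set (set V)) : trivIset setT C -> trivIset setT (fun i => C i `\` W).
  by move=> /trivIsetP tC; apply/trivIsetP => i j _ _ ij; apply/seteqP; split=> // H [[Ci _] [Cj _]];
    rewrite -(tC i j)//.
have FF : P (count_event B k `&` count_event B' k') =
    P (count_event B k) * P (count_event B' k').
  (* Both families are joined into one, to which independence applies. *)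
  pose C (i : 'I_(m + m')) := match fintype.split i with inl j => B j | inr j => B' j end.
  pose l (i : 'I_(m + m')) := match fintype.split i with inl j => k j | inr j => k' j end.
  have Cl j : C (lshift m' j) = B j by rewrite /C (unsplitK (inl j)).
  have Cr j : C (rshift m j) = B' j by rewrite /C (unsplitK (inr j)).
  have ll j : l (lshift m' j) = k j by rewrite /l (unsplitK (inl j)).
  have lr j : l (rshift m j) = k' j by rewrite /l (unsplitK (inr j)).
  have disj i j : B i `&` B' j = set0.
    by apply/seteqP; split=> // H [[/AK KH nW] [/AK' K'H _]]; apply: nW.
  rewrite (_ : _ `&` _ = count_event C l); last first.
    apply/seteqP; split=> [w [h h'] i|w h].
      by rewrite -(fintype.splitK i); case: (fintype.split i) => j /=; rewrite ?Cl ?Cr ?ll ?lr.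
    by split=> i; [have := h (lshift m' i)|have := h (rshift m i)]; rewrite ?Cl ?Cr ?ll ?lr.
  rewrite !count_event_indep//; [|exact: tsub|exact: tsub| |].
  - rewrite big_split_ord/=; congr (_ * _); apply: eq_bigr => i _.
      by rewrite Cl ll.
    by rewrite Cr lr.
  - by move=> i; rewrite -(fintype.splitK i); case: (fintype.split i) => j /=; rewrite ?Cl ?Cr.
  apply/trivIsetP => i j _ _; rewrite -(fintype.splitK i) -(fintype.splitK j).
  case: (fintype.split i) => i'; case: (fintype.split j) => j' /= ij; rewrite ?Cl ?Cr.
  - by move/trivIsetP: (tsub _ _ tA); apply=> //; apply: contraNneq ij => ->.
  - exact: disj.
  - by rewrite setIC; exact: disj.
  - by move/trivIsetP: (tsub _ _ tA'); apply=> //; apply: contraNneq ij => ->.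
have mE := measurable_count_event k mA; have mE' := measurable_count_event k' mA'.
have mF := measurable_count_event k mB; have mF' := measurable_count_event k' mB'.
have le1 : P (count_event A k `&` count_event A' k') <=
    P (count_event B k) * P (count_event B' k') + P N.
  rewrite -FF; apply: le_trans (measureU2 _ _ _); [|exact: measurableI|by []].
  apply: le_measure; [apply/mem_set; exact: measurableI|apply/mem_set|].
    by apply: measurableU => //; exact: measurableI.
  move=> w [Ew E'w]; have [Nw|nN] := pselect (N w); first by right.
  by left; split; apply/swap.
have sub n (C : 'I_n -> set (set V)) l : (forall i, hborel (C i)) ->
    P (count_event (fun i => C i `\` W) l) <= P (count_event C l) + P N.
  move=> mC; have mCW i : hborel (C i `\` W) by exact: hborelD.
  apply: le_trans (measureU2 _ _ _); [|exact: measurable_count_event|by []].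
  apply: le_measure; [apply/mem_set; exact: measurable_count_event|apply/mem_set|].
    by apply: measurableU => //; exact: measurable_count_event.
  by move=> w Fw; have [Nw|nN] := pselect (N w); [right|left; apply/(swap _ C)].
have := sub _ _ k mA; have := sub _ _ k' mA'; move: le1.
have fin E : measurable E -> P E = (fine (P E))%:E.
  by move=> mEE; rewrite fineK//; exact: fin_num_measure.
have ge0 E : (0 <= fine (P E))%R by rewrite fine_ge0.
have le1 E : measurable E -> (fine (P E) <= 1)%R.
  by move=> mEE; rewrite -lee_fin -fin//; exact: probability_le1.
rewrite -/B -/B' (fin _ (measurableI _ _ mE mE')) (fin _ mE) (fin _ mE') (fin _ mF) (fin _ mF') (fin _ mN).
rewrite -!EFinM -!EFinD !lee_fin.
have := ge0 (count_event A k); have := ge0 (count_event A' k').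
have := ge0 (count_event B k); have := ge0 (count_event B' k').
have := ge0 N; have := le1 _ mN; have := le1 _ mE; have := le1 _ mE'.
have := le1 _ mF; have := le1 _ mF'.
move: (fine (P N)) => n.
move: (fine (P (count_event A k))) (fine (P (count_event B k))) => e f.
move: (fine (P (count_event A' k'))) (fine (P (count_event B' k'))) => e' f'.
move=> f'1 f1 e'1 e1 n1 n0 f'0 f0 e'0 e0 h1 h2 h3.
(* The origin of the 4: [f * f' + n <= e * e' + n * (e + e' + n + 1)], and all these probabilities
   are at most 1. *)
have : (f * f' <= (e + n) * (e' + n))%R by exact: ler_pM.
nra.
Qed.

End PointProcess.

(** * Lattice points and intensities *)

Section Lattice.
Variables (R : realType) (d r : nat).
Local Notation V := 'rV[R]_d.

Definition lattice_point N (k : {ffun 'I_d -> 'I_N}) : V := \row_i (2 * r * k i)%:R.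

Lemma natr_dist_ge1 (a b : nat) : a != b -> 1 <= `|a%:R - b%:R : R|.
Proof.
wlog ab : a b / (a <= b)%N.
  move=> w h; have [ab|/ltnW ab] := leqP a b; first exact: w.
  by rewrite distrC; apply: w => //; rewrite eq_sym.
by move=> ne; rewrite distrC -natrB// normr_nat ler1n subn_gt0 ltn_neqAle ne.
Qed.

Lemma unit_coordinate (u : V) : (0 < d)%N -> sphere u -> exists i, 1 <= d%:R * `|u ord0 i|.
Proof.
move=> d0 /sphereE u1; apply: contrapT => /forallNP h.
have hlt i : `|u ord0 i| < d%:R^-1.
  rewrite -[ltRHS]mul1r ltr_pdivlMr ?ltr0n// mulrC ltNge; exact/negP/h.
have : dot u u < \sum_(i < d) d%:R^-1.
  apply: ltr_sum; first by apply/hasP; exists (Ordinal d0); rewrite ?mem_index_enum.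
  move=> i _; rewrite -expr2 -real_normK ?num_real// expr2.
  apply: le_lt_trans (hlt i); rewrite ler_piMl//.
  by rewrite (le_trans (ltW (hlt i)))// invf_le1 ?ltr0n// ler1n.
by rewrite u1 sumr_const card_ord -[_ *+ d]mulr_natr mulVf ?ltxx// pnatr_eq0 -lt0n.
Qed.

(* Some coordinate of u is at least 1/d in absolute value; along that coordinate
   axis, consecutive lattice points near the hyperplane number at most d. *)
Lemma lattice_points_near_hyperplane N (u : V) (tau : R) : (0 < d)%N -> (0 < r)%N -> sphere u ->
  (#|[pred k : {ffun 'I_d -> 'I_N} | (`|dot (lattice_point k) u - tau| < r%:R)%R]| <=
    d * N ^ d.-1)%N.
Proof.
move=> d0 r0 su; have [i ui] := unit_coordinate d0 su.
(* The [i]-th coordinate modulo [d], with the other coordinates, determines the point: two near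
   points on a common axis line differ by less than [d] in [k i]. *)
pose g (k : {ffun 'I_d -> 'I_N}) : 'I_d * {ffun 'I_d.-1 -> 'I_N} :=
  (Ordinal (ltn_pmod (k i) d0), [ffun j => k (lift i j)]).
have -> : (d * N ^ d.-1)%N = #|{: 'I_d * {ffun 'I_d.-1 -> 'I_N}}|.
  by rewrite card_prod card_ffun !card_ord.
apply: (@leq_card_in _ _ g) => k k'; rewrite !inE => hk hk' /= [kk' /ffunP ff].
have off j : j != i -> k j = k' j.
  case: (unliftP i j) => [l ->|->]; last by rewrite eqxx.
  by move=> _; have := ff l; rewrite !ffunE.
have dk : dot (lattice_point k) u - dot (lattice_point k') u =
    2 * r%:R * ((k i)%:R - (k' i)%:R) * u ord0 i.
  rewrite -dotBl /dot (bigD1 i)//= big1 ?addr0 => [|j ji]; last first.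
    by rewrite !mxE off// subrr mul0r.
  by rewrite !mxE !natrM; ring.
have lt_d : `|(k i)%:R - (k' i)%:R : R| < d%:R.
  have h1 : `|dot (lattice_point k) u - dot (lattice_point k') u| < 2 * r%:R.
    have := ler_normB (dot (lattice_point k) u - tau) (dot (lattice_point k') u - tau).
    by rewrite opprB addrA subrK; move: hk hk'; lra.
  have r2 : 0 < 2 * r%:R :> R by rewrite mulr_gt0// ltr0n.
  have {h1} : `|(k i)%:R - (k' i)%:R : R| * `|u ord0 i| < 1.
    move: h1; rewrite dk -mulrA normrM (gtr0_norm r2) -[ltRHS]mulr1 ltr_pM2l//.
    by rewrite normrM.
  move=> h1; apply: le_lt_trans (_ : d%:R * (`|(k i)%:R - (k' i)%:R| * `|u ord0 i|) < _).
    by rewrite mulrCA ler_peMr.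
  by rewrite gtr_pMr// ltr0n.
have ki : k i = k' i.
  have lt_dN (a b : nat) : `|a%:R - b%:R : R| < d%:R -> a = b %[mod d] -> a = b.
    wlog ab : a b / (a <= b)%N.
      move=> w h e; have [ab|ab] := leqP a b; first exact: w.
      by apply/esym/w => //; [exact: ltnW|rewrite distrC].
    rewrite distrC -natrB// normr_nat ltr_nat => ltd e.
    have /eqP := e; rewrite eq_sym eqn_mod_dvd// => /dvdn_leq h.
    apply/eqP; rewrite eqn_leq ab/= -subn_eq0; apply: contraT; rewrite -lt0n => /h.
    by rewrite leqNgt ltd.
  by apply: val_inj; apply: lt_dN.
by apply/ffunP => j; have [->//|/off] := eqVneq j i.
Qed.

Lemma lattice_point_separated N (k k' : {ffun 'I_d -> 'I_N}) (x : V) :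
  `|x - lattice_point k| < r%:R -> `|x - lattice_point k'| < r%:R -> k = k'.
Proof.
move=> hk hk'; apply/ffunP => i; apply/eqP; apply: contraT => kk'.
have : `|lattice_point k - lattice_point k'| < 2 * r%:R.
  have := ler_normB (x - lattice_point k') (x - lattice_point k).
  by rewrite opprB addrC addrA subrK; move: hk hk'; lra.
rewrite ltNge => /negP[]; apply: le_trans (coord_norm _ i).
rewrite !mxE !natrM -mulrBr normrM ger0_norm// ler_peMr//.
exact: natr_dist_ge1.
Qed.

Lemma norm_lattice_point N (k : {ffun 'I_d -> 'I_N}) :
  `|lattice_point k| <= (2 * r * N)%:R.
Proof.
apply: norm_le_coord => // i; rewrite mxE normr_nat ler_nat leq_mul2l.
by rewrite ltnW ?orbT.
Qed.

End Lattice.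

Section Intensity.
Local Open Scope ereal_scope.
Context {disp : measure_display} {Omega : measurableType disp} {R : realType}.
Variables (d : nat) (P : probability Omega R) (X : Omega -> set (set 'rV[R]_d)).
Variable phi : {finite_measure set (borelV R d) -> \bar R}.
Local Notation V := 'rV[R]_d.
Hypothesis hphi : spherical_directional_distribution P X phi.
Hypothesis hsupp : measure_support phi = @sphere R d.

Lemma open_measurable_borelV (U : set (borelV R d)) : open (U : set V) -> measurable U.
Proof. exact: sub_sigma_algebra. Qed.

Lemma measurable_sphere : measurable (@sphere R d : set (borelV R d)).
Proof.
have -> : (@sphere R d : set (borelV R d)) = ~` (~` @sphere R d) by rewrite setCK.
apply: measurableC; apply: open_measurable_borelV.
rewrite openC (_ : @sphere R d = (fun x : V => dot x x) @^-1` [set r | r = 1%R]); last first.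
  by apply/seteqP; split=> x /sphereE.
apply: (@preimage_closed V R); last exact: closed_eq.
move=> x _; apply: (@continuous_big _ _ _ _ _ _ _ _ (fun i (x : V) => x ord0 i * x ord0 i)%R).
  exact: add_continuous.
by move=> i _ y; apply: (@continuousM _ _ (fun x : V => x ord0 i) (fun x : V => x ord0 i));
  exact: coord_continuous.
Qed.

Lemma lebesgue_measure_open_interval (c r : R) : (0 < r)%R ->
  \int[@lebesgue_measure R]_tau (\1_(`]c - r, c + r[%classic) tau : R)%:E = (2 * r)%:E.
Proof.
move=> r0; rewrite integral_indic//= setIT lebesgue_measure_itv/= lte_fin ifT; last lra.
by rewrite -EFinB; congr (_%:E); ring.
Qed.

(** For each direction the offsets form an interval of length [2 * r], whatever [z] is. *)
Lemma intensity_hitting r : (0 < r)%R -> exists2 C : R, (0 <= C)%R &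
  forall z, intensity_measure P X (hitting z r) = C%:E.
Proof.
move=> r0; have [_ _ [g g0 gE]] := hphi.
exists (g * (2 * r * fine (phi (@sphere R d))))%R.
  by rewrite !mulr_ge0// ?fine_ge0// ltW.
move=> z; rewrite gE; last by apply: sub_hborel; exact: hopen_hitting.
rewrite (@eq_integral _ _ _ _ _ (cst (2 * r)%:E)).
  rewrite integral_cst; last exact: measurable_sphere.
  by rewrite !EFinM fineK//; apply: fin_num_measure; exact: measurable_sphere.
move=> u /set_mem su /=; rewrite -(lebesgue_measure_open_interval (dot z u) r0).
apply: eq_integral => t _; congr (_%:E).
rewrite !indicE; congr (_%:R); congr nat_of_bool; apply/idP/idP => /set_mem.
  by rewrite hittingE// ltr_norml => h; apply/mem_set; rewrite /= in_itv/=; lra.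
by rewrite /= in_itv/= => h; apply/mem_set/hittingE => //; rewrite ltr_norml; lra.
Qed.

(** By full support [phi] charges the directions within [e] of [a], and each of them admits an
    interval of offsets of length [2 * e]. *)
Lemma intensity_near_hyperplane_gt0 (z a u : V) (b e : R) : (0 < e)%R -> sphere u -> (`|u - a| < e)%R ->
  0 < intensity_measure P X (near_hyperplane z a b e).
Proof.
move=> e0 su ua; have [phi0 _ [g g0 gE]] := hphi.
rewrite gE; last by apply: sub_hborel; exact: hopen_near_hyperplane.
apply: mule_gt0 => //.
pose B : set (borelV R d) := [set v : V | (`|v - a| < e)%R].
have oB : open (B : set V).
  apply: (@open_norm_lt _ V V (fun v : V => (v - a)%R)) => v.
  by apply: (@continuousB _ V _ id (cst a)); [exact: cvg_id|exact: cst_continuous].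
have mB : measurable B by exact: open_measurable_borelV.
have phiB : 0 < phi B.
  by move: su; rewrite -hsupp => /(_ B oB); apply.
have phiBS : 0 < phi (B `&` @sphere R d).
  apply: lt_le_trans phiB _; rewrite -[leRHS]adde0 -phi0.
  have mS := measurable_sphere.
  apply: le_trans (measureU2 _ _ _); [|exact: measurableI|exact: measurableC].
  apply: le_measure; [exact/mem_set|apply/mem_set/measurableU; [exact: measurableI|exact: measurableC]|].
  by move=> v Bv; have [Sv|] := pselect (sphere v); [left|right].
apply: (@lt_le_trans _ _ (\int[phi]_(v in @sphere R d) ((2 * e)%:E * (\1_B v : R)%:E))).
  rewrite ge0_integralZl_EFin//.
  - rewrite integral_indic//; last exact: measurable_sphere.
    by apply: mule_gt0 => //; rewrite lte_fin mulr_gt0.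
  - exact: measurable_sphere.
  - by apply/measurable_EFinP; exact: measurable_indic.
  - by rewrite mulr_ge0// ltW.
apply: ge0_integral_mono => v sv; first by rewrite mule_ge0// lee_fin ?mulr_ge0// ltW.
rewrite indicE; case: (boolP (v \in B)) => [/set_mem /= va|_]; last first.
  by rewrite mule0; apply: integral_ge0 => t _; rewrite lee_fin.
rewrite mule1 -(lebesgue_measure_open_interval (b + dot z v) e0).
apply: ge0_integral_mono => t _; first by rewrite lee_fin.
rewrite !indicE lee_fin ler_nat; case: (boolP (t \in _)) => // /set_mem.
rewrite /= in_itv/= => ht; rewrite lt0b; apply/mem_set; exists v, t; split=> //; split=> //=.
by rewrite ltr_norml; lra.
Qed.

End Intensity.

(** * Patterns of hyperplanes *)

Lemma sigma_algebra_fin_bigcap (T : Type) (G : set (set T)) m (A : 'I_m -> set T) :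
  (forall i, <<s G >> (A i)) -> <<s G >> (\bigcap_i A i).
Proof.
move=> mA; pose F k := if insub k is Some i then ~` A i else set0.
rewrite (_ : \bigcap_i A i = ~` \bigcup_k F k).
  rewrite -setTD; apply: sigma_algebraCD; apply: sigma_algebra_bigcup => k; rewrite /F.
  by case: insub => [i|]; [rewrite -setTD; exact: sigma_algebraCD|exact: sigma_algebra0].
apply/seteqP; split=> [x xA [k _]|x xF i _].
  by rewrite /F; case: insubP => // i _ _; apply; exact: xA.
by apply: contrapT => nA; apply: xF; exists i => //; rewrite /F valK.
Qed.

Section Patterns.
Local Open Scope ereal_scope.
Variables (R : realType) (d m : nat).
Local Notation V := 'rV[R]_d.
Variables (a : 'I_m -> V) (b : 'I_m -> R) (e : R) (r : nat).

(* The index ord0 stands for the remaining hyperplanes that hit the ball. *)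
Definition pattern_cell (z : V) (j : 'I_m.+1) : set (set V) :=
  if unlift ord0 j is Some i then near_hyperplane z (a i) (b i) e
  else hitting z r%:R `\` \bigcup_i near_hyperplane z (a i) (b i) e.

Definition pattern_count (j : 'I_m.+1) : nat := j != ord0.

Definition pattern (z : V) (S : set (set V)) : Prop :=
  forall j, npoints S (pattern_cell z j) = (pattern_count j)%:R%:E :> \bar R.

(** The bound on [b i] puts the neighbourhoods inside [hitting z r], a unit vector near [a i] gives
    them positive intensity, and the last clause makes them disjoint. *)
Definition admissible : Prop :=
  [/\ (0 < e)%R, (0 < r)%N, forall i, (`|b i| + e <= r%:R)%R,
      forall i, exists2 u, sphere u & (`|u - a i| < e)%R &
      forall i j, i != j ->
        ~ (`|a i - a j| < 2 * e /\ `|b i - b j| < 2 * e)%R /\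
        ~ (`|a i + a j| < 2 * e /\ `|b i + b j| < 2 * e)%R].

Lemma hborel_pattern_cell z j : hborel (pattern_cell z j).
Proof.
rewrite /pattern_cell; case: unlift => [i|].
  by apply: sub_hborel; exact: hopen_near_hyperplane.
apply: hborelD; first by apply: sub_hborel; exact: hopen_hitting.
by apply: hborel_bigcup => i; apply: sub_hborel; exact: hopen_near_hyperplane.
Qed.

Lemma translate_pattern_cell z j H :
  pattern_cell 0 j (translate (- z) H) <-> pattern_cell z j H.
Proof.
rewrite /pattern_cell; case: unlift => [i|]; first exact: translate_near.
split=> -[hH nH]; split.
- exact/translate_hitting.
- by move=> [i _ /translate_near h]; apply: nH; exists i.
- exact/translate_hitting.
- by move=> [i _ /translate_near h]; apply: nH; exists i.
Qed.

Lemma pattern_translate z S : pattern 0 (translate (- z) @` S) <-> pattern z S.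
Proof.
by split=> h j; have := h j; rewrite (npoints_translate _ (translate_pattern_cell z j)).
Qed.

Lemma config_events_pattern : config_events (pattern 0).
Proof.
rewrite (_ : pattern 0 = \bigcap_j [set S | npoints S (pattern_cell 0 j) = (pattern_count j)%:R%:E :> \bar R]).
  apply: sigma_algebra_fin_bigcap => j; apply: sub_sigma_algebra.
  exists (pattern_cell 0 j), [set (pattern_count j)%:R%:E]; split=> //.
  exact: hborel_pattern_cell.
by apply/seteqP; split=> [S h j _|S h j]; exact: h.
Qed.

Hypothesis adm : admissible.

Lemma pattern_cell_hitting z j : pattern_cell z j `<=` hitting z r%:R.
Proof.
rewrite /pattern_cell; case: unlift => [i|]; last by move=> H [].
have [_ _ br _ _] := adm.
move=> _ [u [t [su -> /= [_ ht]]]]; apply/hittingE => //; apply: lt_le_trans (br i).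
have := ler_normB (t - dot z u - b i)%R (- b i)%R; rewrite opprK subrK normrN distrC.
by move: ht; lra.
Qed.

Lemma trivIset_pattern_cell z : trivIset setT (pattern_cell z).
Proof.
have [_ _ _ _ sep] := adm.
apply/trivIsetP => j j' _ _; rewrite /pattern_cell.
case: (unliftP ord0 j) => [i ->|->]; case: (unliftP ord0 j') => [i' ->|->].
- move=> ii'; have /sep[h1 h2] : i != i' by apply: contraNneq ii' => ->.
  exact: near_hyperplane_disjoint.
- by move=> _; apply/seteqP; split=> // H [hH [_]]; apply; exists i.
- by move=> _; apply/seteqP; split=> // H [[_ nH] hH]; apply: nH; exists i'.
- by rewrite eqxx.
Qed.

Section Process.
Context {disp : measure_display} {Omega : measurableType disp}.
Variables (P : probability Omega R) (X : Omega -> set (set V)).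
Variable phi : {finite_measure set (borelV R d) -> \bar R}.
Hypothesis d0 : (0 < d)%N.
Hypothesis hX : stationary_poisson_hyperplane_process P X.
Hypothesis hphi : spherical_directional_distribution P X phi.
Hypothesis hsupp : measure_support phi = @sphere R d.

Definition pattern_event (z : V) : set Omega := [set w | pattern z (X w)].

Lemma hyperplane_processX : hyperplane_process X. Proof. by case: hX. Qed.

Lemma measurable_pattern_event z : measurable (pattern_event z).
Proof.
apply: (measurable_count_event hyperplane_processX pattern_count).
exact: hborel_pattern_cell.
Qed.

Lemma pattern_event_stationary z : P (pattern_event z) = P (pattern_event 0).
Proof.
have [_ _ stat _ _] := hX.
rewrite /pattern_event (stat (- z)%R _ config_events_pattern).
by congr (P _); apply/seteqP; split=> w /= /pattern_translate.
Qed.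

Lemma intensity_mono (A B : set (set V)) : A `<=` B ->
  intensity_measure P X A <= intensity_measure P X B.
Proof.
move=> AB; apply: ge0_integral_mono => w _; first exact: counting_ge0.
exact: npoints_mono.
Qed.

Lemma intensity_ge0 A : 0 <= intensity_measure P X A.
Proof. by apply: integral_ge0 => w _; exact: counting_ge0. Qed.

(** A product of Poisson probabilities with finite parameters: that of the value 0 is always
    positive, that of the value 1 is positive for a neighbourhood of positive intensity. *)
Lemma pattern_event_gt0 : 0 < P (pattern_event 0).
Proof.
have [e0 r0 _ su _] := adm; have [_ [pois ind] _ _ _] := hX.
rewrite (count_event_indep (X := X) ind); [|exact: hborel_pattern_cell|exact: trivIset_pattern_cell].
have [|C C0 hC] := intensity_hitting hphi (r := r%:R); first by rewrite ltr0n.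
have fin j : intensity_measure P X (pattern_cell 0 j) < +oo.
  apply: le_lt_trans (intensity_mono (@pattern_cell_hitting 0 j)) _.
  by rewrite hC ltry.
elim/big_ind: _ => [|x y|j _]; [exact: lte01|exact: mule_gt0|].
rewrite (pois _ (hborel_pattern_cell 0%R j) (fin j)) lte_fin divr_gt0 ?ltr0n ?fact_gt0//.
rewrite mulr_gt0 ?expR_gt0// /pattern_count.
case: (unliftP ord0 j) (fin j) => [i ->|->]; last by rewrite eqxx expr0.
rewrite eq_sym neq_lift expr1 => fi; rewrite fine_gt0// fi andbT.
rewrite /pattern_cell liftK; have [u suu ua] := su i.
by apply: (intensity_near_hyperplane_gt0 hphi hsupp); [exact: e0|exact: suu|exact: ua].
Qed.

Lemma lattice_intensity_sum N (t : {ffun 'I_d -> 'I_N}) (C : R) : (0 < N)%N ->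
  (forall z, intensity_measure P X (hitting z r%:R) = C%:E) ->
  \sum_t' intensity_measure P X
    (hitting (lattice_point R r t) r%:R `&` hitting (lattice_point R r (t' : {ffun 'I_d -> 'I_N})) r%:R) <=
  ((d * N ^ d.-1)%:R * C)%:E.
Proof.
move=> N0 hC; have [_ r0 _ _ _] := adm; have [hH _ _ _ _] := hX; have [Xh _ mX] := hH.
have mh z : hborel (hitting z (r%:R : R) : set (set V)).
  by apply: sub_hborel; exact: hopen_hitting.
rewrite -ge0_integral_sum//; last 2 first.
- by move=> t'; apply: mX; exact: hborelI.
- by move=> t' w _; exact: counting_ge0.
rewrite EFinM -(hC (lattice_point R r t)) -ge0_integralZl_EFin//; last 2 first.
- by move=> w _; exact: counting_ge0.
- by apply: mX.
apply: ge0_integral_mono => w _; first by apply: sume_ge0 => t' _; exact: counting_ge0.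
apply: sum_npoints_le; first by rewrite muln_gt0 d0 expn_gt0 N0.
move=> H /Xh[u [tau [su ->]]] _.
apply: leq_trans (lattice_points_near_hyperplane N tau d0 r0 su).
rewrite subset_leq_card//; apply/fintype.subsetP => k; rewrite !inE.
by move=> /asboolP/hittingE; exact.
Qed.

Definition pattern_count_on (N : nat) (w : Omega) : R :=
  occurrences (fun k : {ffun 'I_d -> 'I_N} => pattern_event (lattice_point R r k)) w.

Lemma few_patterns : exists p K : R, [/\ (0 < p)%R, (0 <= K)%R &
  forall N, (0 < N)%N ->
  P [set w | (pattern_count_on N w <= p * (N ^ d)%:R / 2)%R] <= (K / N%:R)%:E].
Proof.
have [_ r0 _ _ _] := adm; have [hH [pois ind] _ _ _] := hX.
have [|C C0 hC] := intensity_hitting hphi (r := r%:R); first by rewrite ltr0n.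
have mh z : hborel (hitting z (r%:R : R) : set (set V)).
  by apply: sub_hborel; exact: hopen_hitting.
pose p := fine (P (pattern_event 0)).
have Pp z : P (pattern_event z) = p%:E.
  rewrite pattern_event_stationary fineK// fin_num_measure//.
  exact: measurable_pattern_event.
have p0 : (0 < p)%R by rewrite -lte_fin -(Pp 0%R) pattern_event_gt0.
(* 16 is 4 from Chebyshev times 4 from the covariances, whose sum is at most
   [4 * N ^ d * (d * N ^ d.-1 * C)]; dividing by [(p * N ^ d) ^+ 2] leaves [1 / N]. *)
exists p, (16 * d%:R * C / p ^+ 2)%R; split=> //.
  by rewrite divr_ge0 ?sqr_ge0// !mulr_ge0.
move=> N N0.
pose T := {ffun 'I_d -> 'I_N}.
pose I (t t' : T) := intensity_measure P X
  (hitting (lattice_point R r t) r%:R `&` hitting (lattice_point R r t') r%:R).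
have Ifin t t' : I t t' = (fine (I t t'))%:E.
  rewrite fineK// ge0_fin_numE ?intensity_ge0//.
  apply: le_lt_trans (intensity_mono (@subIsetl _ _ _)) _.
  by rewrite hC ltry.
have cT : #|{: T}| = (N ^ d)%N by rewrite card_ffun !card_ord.
have M0 : (0 < #|{: T}|)%N by rewrite cT expn_gt0 N0.
have := @few_occurrences _ _ _ P T (fun t => pattern_event (lattice_point R r t)) p
  (fun t t' => 4 * fine (I t t'))%R
  (fun t => measurable_pattern_event _) (fun t => Pp _) _ p0 M0.
rewrite cT => h; apply: le_trans (h _) _ => [t t'|].
  apply: le_trans (covariance_bound hH ind pattern_count pattern_count
    (hborel_pattern_cell _) (hborel_pattern_cell _) (mh (lattice_point R r t))
    (mh (lattice_point R r t')) (@trivIset_pattern_cell _)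
    (@trivIset_pattern_cell _) (@pattern_cell_hitting _) (@pattern_cell_hitting _)) _.
  have PA z : P (count_event X (pattern_cell z) pattern_count) = p%:E by exact: Pp.
  rewrite !PA [leRHS]EFinD -EFinM expr2; apply: leeD2l.
  rewrite EFinM -Ifin; apply: lee_wpmul2l; first by rewrite lee_fin.
  by apply: prob_meets_le => //; exact: hborelI.
rewrite lee_fin.
have sumI : (\sum_t \sum_t' 4 * fine (I t t') <=
    4 * ((N ^ d)%:R * ((d * N ^ d.-1)%:R * C)))%R.
  rewrite (eq_bigr (fun t => 4 * \sum_t' fine (I t t')))%R => [|t _]; last by rewrite mulr_sumr.
  rewrite -mulr_sumr ler_pM2l// -cT mulr_natl -sumr_const; apply: ler_sum => t _.
  rewrite -lee_fin -sumEFin (eq_bigr (I t)) => [|t' _]; last by rewrite -Ifin.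
  exact: lattice_intensity_sum.
have Nd : ((N ^ d)%:R = N%:R * (N ^ d.-1)%:R :> R)%R.
  by rewrite -natrM -expnS prednK.
have N0' : (0 < N%:R :> R)%R by rewrite ltr0n.
have N1 : (0 < (N ^ d.-1)%:R :> R)%R by rewrite ltr0n expn_gt0 N0.
apply: (@le_trans _ _ (4 * (4 * ((N ^ d)%:R * ((d * N ^ d.-1)%:R * C))) / (p * (N ^ d)%:R) ^+ 2)%R).
  by rewrite ler_wpM2r ?invr_ge0 ?sqr_ge0// ler_pM2l.
rewrite Nd natrM le_eqVlt; apply/orP; left; apply/eqP; field.
by rewrite !gt_eqF.
Qed.

Lemma pattern_density : {ae P, forall w, exists c n0, (0 < c)%R /\
  forall n, (n0 <= n)%N -> (c * ((2 ^ n) ^ d)%:R <= pattern_count_on (2 ^ n) w)%R}.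
Proof.
have [p [K [p0 K0 hP]]] := few_patterns.
pose F n := [set w | (pattern_count_on (2 ^ n) w <= p * ((2 ^ n) ^ d)%:R / 2)%R].
have mF n : measurable (F n).
  rewrite /F -[X in measurable X]setTI; apply: measurable_fun_le => //.
  by apply: measurable_occurrences => t; exact: measurable_pattern_event.
exists (lim_sup_set F); split.
- by apply: bigcap_measurable => // k _; exact: bigcup_measurable.
- apply: lim_sup_set_cvg0 => //.
  apply: (@le_lt_trans _ _ (2 * K)%:E); last exact: ltry.
  (* [K / 2 ^ n] is [2 * K / 2 ^ n.+1], so the series sums to at most [2 * K] and Borel-Cantelli
     applies. *)
  have := @epsilon_trick0 R (2 * K) xpredT; rewrite mulr_ge0// => /(_ isT).
  apply: le_trans; apply: lee_nneseries => // n _.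
  apply: le_trans (hP _ _) _; first by rewrite expn_gt0.
  rewrite lee_fin expnS natrM le_eqVlt; apply/orP; left; apply/eqP; field.
  by rewrite pnatr_eq0 expn_eq0.
move=> w nw n _; apply: contrapT => nF; apply: nw; exists (p / 2)%R, n; split.
  by rewrite divr_gt0.
move=> k nk; rewrite leNgt; apply/negP => lt; apply: nF; exists k => //.
by rewrite /F/= mulrAC ltW.
Qed.

End Process.
End Patterns.

(** * Density of cells *)

Section PatternCells.
Variables (R : realType) (d m : nat).
Local Notation V := 'rV[R]_d.

Lemma npoints1 (S A : set (set V)) : npoints S A = 1%E :> \bar R ->
  exists H, [/\ S H, A H & forall H', S H' -> A H' -> H' = H].
Proof.
move=> /counting_set1[H SA].
have [SH AH] : (S `&` A) H by rewrite SA.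
exists H; split=> // H' SH' AH'.
by have : (S `&` A) H' by []; rewrite SA.
Qed.

Lemma npoints0 (S A : set (set V)) : npoints S A = 0%E :> \bar R ->
  forall H, S H -> ~ A H.
Proof. by move=> /counting_set0 SA H SH AH; have : (S `&` A) H by []; rewrite SA. Qed.

(** The hyperplanes found in the neighbourhoods, moved back by [z], are within [2 * e] of the data
    of [Q]: [e] for the neighbourhood and [e] for its centre. Their polyhedron has Euclidean radius
    at most [d * M < r] about [z], so every hyperplane of [S] meeting it hits the ball and is one of
    them. *)
Lemma pattern_tessellation_cell (u : 'I_m -> V) (tau : 'I_m -> R) (x0 : V) (eQ M : R)
    (a : 'I_m -> V) (b : 'I_m -> R) (e : R) (r : nat) (z : V) (S : set (set V)) :
  (forall u' tau', close_to u tau eQ u' tau' ->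
    [/\ forall i, dot x0 (u' i) < tau' i, forall x, hpoly u' tau' x -> `|x| <= M &
        tight_family u tau = tight_family u' tau']) ->
  (forall i, `|a i - u i| < e /\ `|b i - tau i| < e) -> 2 * e <= eQ ->
  d%:R * M < r%:R -> S `<=` @hyperplanes R d -> pattern a b e r z S ->
  exists C, [/\ induced_tessellation S C, combinatorial_type (hpoly u tau) C,
    C !=set0 & forall x, C x -> `|x - z| <= M].
Proof.
move=> stab ab eeQ Mr SH pat.
have /choice[H HP] : forall i, exists H, [/\ S H, near_hyperplane z (a i) (b i) e H &
    forall H', S H' -> near_hyperplane z (a i) (b i) e H' -> H' = H].
  move=> i; have := pat (lift ord0 i).
  by rewrite /pattern_cell liftK /pattern_count eq_sym neq_lift => /npoints1.
have rest K : S K -> hitting z r%:R K -> exists i, K = H i.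
  move=> SK hK; have := pat ord0.
  rewrite /pattern_cell unlift_none /pattern_count eqxx => /npoints0/(_ _ SK) nK.
  apply: contrapT => nH; apply: nK; split=> // -[i _ Ki]; apply: nH; exists i.
  by have [_ _] := HP i; apply.
have /choice[v vP] : forall i, exists v : V * R, [/\ H i = hyperplane v.1 v.2,
    `|v.1 - a i| < e & `|v.2 - dot z v.1 - b i| < e].
  move=> i; have [_ [v [t [_ HE /= [va tb]]]] _] := HP i.
  by exists (v, t).
pose u' i := (v i).1; pose t' i := (v i).2; pose tau' i := t' i - dot z (u' i).
have cl : close_to u tau eQ u' tau'.
  move=> i; have [_ va tb] := vP i; have [au bt] := ab i.
  split; apply: (lt_le_trans _ eeQ).
    have := ler_normD (u' i - a i) (a i - u i); rewrite addrA subrK.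
    by move: va au; rewrite /u'; lra.
  have := ler_normD (tau' i - b i) (b i - tau i); rewrite addrA subrK.
  by move: tb bt; rewrite /tau' /t' /u'; lra.
have [x0P bM tE] := stab _ _ cl.
have shift x : hpoly u' t' x <-> hpoly u' tau' (x - z).
  by split=> h i; have := h i; rewrite dotBl /tau' lerBlDr subrK.
have zM x : hpoly u' t' x -> `|x - z| <= M by move=> /shift/bM.
have x0t i : dot (x0 + z) (u' i) < t' i.
  by have := x0P i; rewrite /tau' dotDl ltrBrDr.
have ne : hpoly u' t' !=set0 by exists (x0 + z) => i; exact: ltW.
exists (hpoly u' t'); split=> //.
- apply: (induced_tessellation_cell x0t) => [i|K SK [x [Kx Px]]].
    by have [<- _ _] := vP i; have [] := HP i.
  have [|i ->] := rest K SK; last by exists i; have [] := vP i.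
  apply: (meets_ball_hitting (SH _ SK) Kx).
  apply: le_lt_trans (enorm_norm _) _; apply: le_lt_trans Mr.
  by rewrite ler_wpM2l// zM.
split.
  apply: bounded_hpoly_polytope => //; exists (M + `|z|) => x /zM xz.
  by rewrite -(subrK z x) (le_trans (ler_normD _ _))// lerD2r.
apply: tight_family_combinatorially_isomorphic; rewrite tE.
have tz x : tight u' t' (x + z) = tight u' tau' x.
  by apply/setP => i; rewrite !inE dotDl /tau' eq_sym [RHS]eq_sym subr_eq.
apply/seteqP; split=> [_ [x Px <-]|_ [x /shift Px <-]].
  by exists (x + z); rewrite ?tz//; apply/shift; rewrite addrK.
by exists (x - z) => //; rewrite -tz subrK.
Qed.

End PatternCells.

Lemma norm_sub_lt4 (R : realType) (W : normedModType R) (x y x' y' : W) (e : R) :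
  `|x' - x| < e -> `|y' - y| < e -> `|x' - y'| < 2 * e -> `|x - y| < 4 * e.
Proof.
have := ler_distD x' x y; have := ler_distD y' x' y.
by rewrite (distrC x x'); lra.
Qed.

Section Density.
Local Open Scope ereal_scope.
Variables (R : realType) (d : nat).
Local Notation V := 'rV[R]_d.

Lemma esum_indic_ge (I : finType) (good : pred I) (f : I -> set V) (A T : set (set V)) :
  (forall k, good k -> T (f k) /\ A (f k)) ->
  (forall k k', good k -> good k' -> f k = f k' -> k = k') ->
  #|good|%:R%:E <= \esum_(Q in T) (\1_A Q : R)%:E.
Proof.
move=> fT finj.
pose X := [fset f k | k in good]%fset.
have cX : #|` X| = #|good|.
  rewrite card_in_imfset//= ?cardE// => k k'; exact: finj.
apply: esum_ge; exists [set` X].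
  split; first exact: finite_fset.
  by move=> Q /= /imfsetP[k /= gk ->]; have [] := fT k gk.
rewrite fsbig_finite//= set_fsetK (eq_big_seq (fun=> 1)) => [|Q].
  by rewrite (eq_bigr (fun=> 1%N%:R%:E))// sumEFin -natr_sum sum1_size -cX.
by move=> /imfsetP[k /= gk ->]; rewrite indicE mem_set//; have [] := fT k gk.
Qed.

Lemma box_volume_ge0 (x y : V) : (forall i, (x ord0 i <= y ord0 i)%R) -> (0 <= box_volume x y)%R.
Proof. by move=> xy; apply: prodr_ge0 => i _; rewrite subr_ge0. Qed.

Lemma lebesgueV_ge0 (A : set V) : 0 <= lebesgueV A.
Proof.
apply: le_ereal_inf_tmp => _ [ab [abP _] <-].
by apply: nneseries_ge0 => k _ _; rewrite lee_fin box_volume_ge0.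
Qed.

Lemma lebesgueV_eball n : (0 < d)%N -> lebesgueV (@eball R d n%:R) <= ((2 * n) ^ d)%:R%:E.
Proof.
move=> d0; apply: ereal_inf_lbound.
(* The boxes after the first one are points, of volume 0 as d > 0. *)
pose ab (k : nat) : V * V := if k == 0%N then (const_mx (- n%:R)%R, const_mx n%:R%R) else (0, 0)%R.
exists ab; first split.
- by move=> [|k] i; rewrite /ab/= !mxE// (@le_trans _ _ 0%R)// oppr_le0.
- move=> x xn; exists 0%N => // i; rewrite /ab/= !mxE -ler_norml.
  by apply: le_trans (coord_norm _ _) _; apply: le_trans (norm_enorm _) xn.
rewrite (@nneseries_split _ _ 0 1)//; last first.
  by move=> k _; rewrite lee_fin box_volume_ge0// => i; case: k => [|k]; rewrite /ab/= !mxE// (@le_trans _ _ 0%R)// oppr_le0.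
rewrite add0n big_nat1 eseries0 ?adde0 => [|k k1 _].
  rewrite /ab/= /box_volume; congr (_%:E).
  under eq_bigr do rewrite !mxE opprK -natrD addnn -mul2n.
  by rewrite prodr_const card_ord natrX.
rewrite /ab gtn_eqF// /box_volume (bigD1 (Ordinal d0))//= !mxE subrr mul0r //.
Qed.

(* y = 0 is allowed, since 0^-1 = +oo in \bar R; so no lower bound on the volume
   of balls is needed. *)
Lemma ratio_ge (x y : \bar R) (c L : R) : (0 < c)%R -> (0 < L)%R ->
  c%:E <= x -> 0 <= y -> y <= L%:E -> (c / L)%:E <= x / y.
Proof.
move=> c0 L0 cx y0 yL; have x0 : 0 < x by apply: lt_le_trans cx.
case: y y0 yL => [y| |]//; rewrite !lee_fin => y0 yL.
have [->|yn0] := eqVneq y 0%R; first by rewrite inve0 gt0_muley// leey.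
have y_gt0 : (0 < y)%R by rewrite lt_neqAle eq_sym yn0.
rewrite inver (negbTE yn0); apply: (@le_trans _ _ (c%:E * (y^-1)%:E)).
  by rewrite -EFinM lee_fin ler_pM2l// lef_pV2.
by apply: lee_wpmul2r => //; rewrite lee_fin invr_ge0.
Qed.

Lemma limn_einf_ge (v : nat -> \bar R) (c : \bar R) n0 :
  (forall n, (n0 <= n)%N -> c <= v n) -> c <= limn_einf v.
Proof.
move=> h; rewrite limn_einf_lim; apply: lime_ge; first exact: is_cvg_einfs.
exists n0 => // n /= nn0; apply: le_ereal_inf_tmp => _ [k /= nk <-].
by apply: h; rewrite (leq_trans nn0).
Qed.

End Density.

Section Final.
Local Open Scope ereal_scope.
Variables (R : realType) (d : nat).
Local Notation V := 'rV[R]_d.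
Hypothesis d0 : (0 < d)%N.

Section OnePattern.
Variables (m : nat) (u : 'I_m -> V) (tau : 'I_m -> R) (x0 : V) (eQ M : R).
Hypothesis stab : forall u' tau', close_to u tau eQ u' tau' ->
  [/\ forall i, (dot x0 (u' i) < tau' i)%R, forall x, hpoly u' tau' x -> (`|x| <= M)%R &
      tight_family u tau = tight_family u' tau'].
Variables (a : 'I_m -> V) (b : 'I_m -> R) (e : R) (r : nat) (S : set (set V)).
Hypothesis ab : forall i, (`|a i - u i| < e)%R /\ (`|b i - tau i| < e)%R.
Hypothesis eeQ : (2 * e <= eQ)%R.
Hypothesis r0 : (0 < r)%N.
Hypothesis dMr : (d%:R * M < r%:R)%R.
Hypothesis SH : S `<=` @hyperplanes R d.

(** The cells are nonempty and lie in disjoint balls, so they are distinct. Lattice points have norm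
    at most [2 * r * N] and cells add less than [r <= r * N]; the factor [d] passes to the Euclidean
    norm. *)
Lemma pattern_cells_count N n : (0 < N)%N -> (d * (3 * r) * N <= n)%N ->
  #|[pred k : {ffun 'I_d -> 'I_N} | `[< pattern a b e r (lattice_point R r k) S >]]|%:R%:E <=
  \esum_(C in [set C | induced_tessellation S C /\ C `<=` eball n%:R])
    (\1_(combinatorial_type (hpoly u tau)) C : R)%:E.
Proof.
move=> N0 Nn.
have Mr : (M < r%:R)%R.
  have [M0|M0] := leP 0%R M; last by rewrite (lt_le_trans M0).
  by apply: le_lt_trans dMr; rewrite ler_peMl// ler1n.
have /choice[f fP] : forall k : {ffun 'I_d -> 'I_N}, exists C : set V,
    pattern a b e r (lattice_point R r k) S ->
    [/\ induced_tessellation S C, combinatorial_type (hpoly u tau) C,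
    C !=set0 & forall x, C x -> (`|x - lattice_point R r k| <= M)%R].
  move=> k; have [pat|npat] := pselect (pattern a b e r (lattice_point R r k) S); last first.
    by exists set0.
  by have [C hC] := pattern_tessellation_cell stab ab eeQ dMr SH pat; exists C.
apply: (esum_indic_ge (f := f)) => [k /asboolP/fP[TC AC _ CM]|k k' /asboolP/fP[_ _ [x Cx] CM] /asboolP/fP[_ _ _ CM'] ff].
  split=> //; split=> // x Cx; apply: le_trans (enorm_norm _) _.
  have xM : (`|x| <= (3 * r * N)%:R)%R.
    rewrite -(subrK (lattice_point R r k) x) (le_trans (ler_normD _ _))//.
    have h1 := CM _ Cx; have h2 := norm_lattice_point R r k.
    have h3 : (r%:R <= (r * N)%:R :> R)%R by rewrite ler_nat leq_pmulr.
    have -> : ((3 * r * N)%:R = (r * N)%:R + (2 * r * N)%:R :> R)%R.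
      by rewrite -natrD; congr (_%:R); lia.
    by apply: lerD => //; apply: le_trans h3; apply: le_trans h1 (ltW Mr).
  apply: (@le_trans _ _ (d%:R * (3 * r * N)%:R)%R); first by rewrite ler_wpM2l.
  by rewrite -natrM ler_nat mulnA.
apply: (@lattice_point_separated R d r N k k' x).
  exact: le_lt_trans (CM _ Cx) Mr.
by apply: le_lt_trans Mr; apply: CM'; rewrite -ff.
Qed.

Lemma pattern_counts_positive_density (c : R) n0 : (0 < c)%R ->
  (forall n, (n0 <= n)%N -> (c * ((2 ^ n) ^ d)%:R <=
    #|[pred k : {ffun 'I_d -> 'I_(2 ^ n)} | `[< pattern a b e r (lattice_point R r k) S >]]|%:R)%R) ->
  appears_with_positive_density (induced_tessellation S) (combinatorial_type (hpoly u tau)).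
Proof.
move=> c0 hc.
pose D := (d * (3 * r))%N.
have D0 : (0 < D)%N by rewrite !muln_gt0 d0 r0.
have D4 : (0 < ((4 * D) ^ d)%:R :> R)%R by rewrite ltr0n expn_gt0 muln_gt0 D0.
apply: (@lt_le_trans _ _ (c / ((4 * D) ^ d)%:R)%:E); first by rewrite lte_fin divr_gt0.
apply: (@limn_einf_ge _ _ _ (D * 2 ^ n0)) => n nD.
(* The largest [j] with [D * 2 ^ j <= n]. Then [n < D * 2 ^ j.+1], so the cube of side [2 * n]
   around the ball has volume at most [(4 * D * 2 ^ j) ^ d], comparable to the number of lattice
   points. *)
pose j := trunc_log 2 (n %/ D).
have nD1 : (0 < n %/ D)%N.
  by rewrite divn_gt0//; apply: leq_trans nD; rewrite leq_pmulr// expn_gt0.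
have jle : (2 ^ j <= n %/ D)%N by exact: trunc_logP.
have jlt : (n %/ D < 2 ^ j.+1)%N by exact: trunc_log_ltn.
have n0j : (n0 <= j)%N.
  rewrite /j trunc_log_max// leq_divRL// mulnC //.
have j0 : (0 < 2 ^ j)%N by rewrite expn_gt0.
have jn : (D * 2 ^ j <= n)%N by rewrite mulnC -leq_divRL.
have n2 : (2 * n <= 4 * D * 2 ^ j)%N.
  by move: jlt; rewrite ltn_divLR// expnS => /ltnW; lia.
have cE : (c / ((4 * D) ^ d)%:R = c * ((2 ^ j) ^ d)%:R / ((4 * D * 2 ^ j) ^ d)%:R)%R.
  move: (4 * D)%N => D'; rewrite expnMn natrM -mulf_div.
  rewrite [((_ ^ _)%N%:R / (_ ^ _)%N%:R)%R]divff ?mulr1//.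
rewrite cE; apply: ratio_ge.
- by rewrite mulr_gt0// ltr0n expn_gt0 j0.
- by rewrite ltr0n expn_gt0 (muln_gt0 (4 * D)) (muln_gt0 4) D0 j0.
- apply: le_trans (pattern_cells_count j0 jn); rewrite lee_fin; exact: hc.
- exact: lebesgueV_ge0.
- apply: (@le_trans _ _ ((2 * n) ^ d)%N%:R%:E); first exact: lebesgueV_eball.
  by rewrite lee_fin ler_nat leq_exp2r.
Qed.

End OnePattern.

(* Rational centres and tolerance make the type of patterns countable. *)
Definition pattern_code := {m : nat & (({ffun 'I_m -> 'rV[rat]_d * rat}) * (rat * nat))%type}.

Definition code_normal (p : pattern_code) (i : 'I_(tag p)) : V :=
  map_mx ratr ((tagged p).1 i).1.
Definition code_offset (p : pattern_code) (i : 'I_(tag p)) : R :=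
  ratr ((tagged p).1 i).2.
Definition code_tolerance (p : pattern_code) : R := ratr (tagged p).2.1.
Definition code_radius (p : pattern_code) : nat := (tagged p).2.2.

Lemma rat_vector_approx (u : V) (e : R) : (0 < e)%R ->
  exists q : 'rV[rat]_d, (`|map_mx ratr q - u| < e)%R.
Proof.
move=> e0; have e2 : (0 < e / 2)%R by rewrite divr_gt0.
have /choice[q qP] : forall i, exists q : rat, (`|ratr q - u ord0 i| < e / 2)%R.
  move=> i; have [|q] := @rat_in_itvoo R (u ord0 i - e / 2)%R (u ord0 i + e / 2)%R; first lra.
  by rewrite in_itv/= => h; exists q; rewrite ltr_norml; lra.
exists (\row_i q i); apply: (@le_lt_trans _ _ (e / 2)%R); last lra.
by apply: norm_le_coord => [|i]; [exact: ltW|rewrite !mxE ltW].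
Qed.

Lemma exists_pattern_code (Q : set V) : simple_dpolytope Q ->
  exists (p : pattern_code) (u : 'I_(tag p) -> V) (tau : 'I_(tag p) -> R) (x0 : V) (eQ M : R),
  [/\ Q = hpoly u tau, admissible (code_normal (p := p)) (code_offset (p := p)) (code_tolerance p) (code_radius p),
      forall u' tau', close_to u tau eQ u' tau' ->
        [/\ forall i, (dot x0 (u' i) < tau' i)%R, forall x, hpoly u' tau' x -> (`|x| <= M)%R &
        tight_family u tau = tight_family u' tau'],
      forall i, (`|code_normal i - u i| < code_tolerance p)%R /\
        (`|code_offset i - tau i| < code_tolerance p)%R &
      (2 * code_tolerance p <= eQ)%R /\ (d%:R * M < (code_radius p)%:R)%R].
Proof.
move=> sQ; have [pQ _ _] := sQ.
have [m [u [tau [QE su inj solv [x0 x0P]]]]] := simple_halfspaces d0 sQ.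
have bQ : norm_bounded (hpoly u tau) by rewrite -QE; exact: polytope_bounded.
rewrite QE in solv.
have [eQ [M [eQ0 M0 stab]]] := tight_family_stability bQ x0P solv.
(* Distance between two bounding hyperplanes over both orientations. It is positive: equal pairs are
   excluded by injectivity, opposite ones because [x0] is strict in both inequalities. *)
pose s (ij : 'I_m * 'I_m) := Order.min
  (Order.max `|u ij.1 - u ij.2| `|tau ij.1 - tau ij.2|)%R
  (Order.max `|u ij.1 + u ij.2| `|tau ij.1 + tau ij.2|)%R.
have s0 ij : ij.1 != ij.2 -> (0 < s ij)%R.
  case: ij => i j /= ij; rewrite /s lt_min !lt_max !normr_gt0 !subr_eq0 !addr_eq0.
  apply/andP; split; rewrite -negb_and; apply: contraNN ij => /andP[/eqP ui /eqP ti].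
    by apply/eqP/inj; rewrite ui ti.
  have := x0P i; have := x0P j; rewrite ui ti dotNr; lra.
(* The 4 covers the separation [2 * e] demanded of the centres and the error [e] of each of the two
   rational centres. *)
have [t [t0 t1 tP]] := @small_step R _ (fun ij => ij.1 != ij.2) (fun=> 4%R) s s0.
have [q0] : exists q : rat, (0 < ratr q :> R)%R /\ (ratr q < Order.min t (eQ / 2)%R :> R)%R.
  have [|q] := @rat_in_itvoo R 0%R (Order.min t (eQ / 2)%R); first by rewrite lt_min t0 divr_gt0.
  by rewrite in_itv/= => /andP[]; exists q.
rewrite lt_min; set e : R := ratr q0 => -[e0 /andP[et eeQ]].
have /choice[a aP] := fun i => rat_vector_approx (u i) e0.
have /choice[b bP] : forall i, exists q : rat, (`|ratr q - tau i| < e)%R.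
  move=> i; have [|q] := @rat_in_itvoo R (tau i - e)%R (tau i + e)%R; first lra.
  by rewrite in_itv/= => h; exists q; rewrite ltr_norml; lra.
pose B : R := (\sum_i `|ratr (b i)| + e + d%:R * M + 1)%R.
have sb0 : (0 <= \sum_i `|ratr (b i) : R|)%R by exact: sumr_ge0.
have dM0 : (0 <= d%:R * M)%R by rewrite mulr_ge0.
have B0 : (0 <= B)%R by rewrite /B; lra.
pose r := Num.bound B.
have Br : (B < r%:R)%R by exact: archi_boundP.
pose p : pattern_code := Tagged (fun m => ({ffun 'I_m -> 'rV[rat]_d * rat} * (rat * nat))%type)
  ([ffun i => (a i, b i)], (q0, r)).
have anE i : code_normal (p := p) i = map_mx ratr (a i) by rewrite /code_normal/= ffunE.
have boE i : code_offset (p := p) i = ratr (b i) by rewrite /code_offset/= ffunE.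
exists p, u, tau, x0, eQ, M; split=> //.
- split=> //.
  + move=> i; rewrite boE; apply/ltW; apply: le_lt_trans Br; rewrite -[code_tolerance p]/e.
    have : (`|ratr (b i) : R| <= \sum_i `|ratr (b i)|)%R by rewrite (bigD1 i)//= lerDl sumr_ge0.
    by rewrite /B; lra.
  + by move=> i; exists (u i); [exact: su|rewrite anE distrC; exact: aP].
  move=> i j ij; rewrite !anE !boE -[code_tolerance p]/e.
  have := tP (i, j) ij; rewrite /s/= lt_min !lt_max => /andP[h1 h2].
  split=> -[ha hb].
    have := norm_sub_lt4 (aP i) (aP j) ha; have := @norm_sub_lt4 _ R^o _ _ _ _ _ (bP i) (bP j) hb.
    by case/orP: h1; lra.
  have Nn (W : normedModType R) (x' x : W) : (`|x' - x| < e)%R -> (`|- x' - - x| < e)%R.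
    by rewrite -opprD normrN.
  have := @norm_sub_lt4 _ _ (u i) (- u j)%R _ (- map_mx ratr (a j))%R _ (aP i) (Nn _ _ _ (aP j)).
  have := @norm_sub_lt4 _ R^o (tau i) (- tau j)%R _ (- ratr (b j))%R _ (bP i) (Nn R^o _ _ (bP j)).
  rewrite !opprK => /(_ hb) k1 /(_ ha) k2.
  by case/orP: h2; lra.
- by move=> i; rewrite anE boE.
split; first by rewrite -[code_tolerance p]/e; lra.
apply: le_lt_trans Br; rewrite /B.
by rewrite -[leLHS]add0r; lra.
Qed.

End Final.

Local Open Scope ereal_scope.

Theorem theorem1 (R : realType) (d : nat) (hd : (2 <= d)%N)
    (disp : measure_display) (Omega : measurableType disp)
    (P : probability Omega R) (X : Omega -> set (set 'rV[R]_d))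
    (phi : {finite_measure set (borelV R d) -> \bar R})
    (hX : stationary_poisson_hyperplane_process P X)
    (hphi : spherical_directional_distribution P X phi)
    (hsupp : measure_support phi = @sphere R d)
    (hgreat : forall L : {vspace 'rV[R]_d}, \dim L = d.-1 ->
      phi (@sphere R d `&` [set` L]) = 0) :
  {ae P, forall w, forall Q : set 'rV[R]_d, simple_dpolytope Q ->
    appears_with_positive_density (induced_tessellation (X w))
      (combinatorial_type Q)}.
Proof.
have d0 : (0 < d)%N by exact: ltn_trans hd.
(* Codes are enumerated by naturals to stay within countable intersections. The exceptional set is
   fixed before [Q] is chosen. *)
have H : {ae P, forall w, forall (n : nat) (p : pattern_code d), choice.unpickle n = Some p ->
    admissible (@code_normal R d p) (@code_offset R d p) (code_tolerance R p) (code_radius p) ->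
    exists c n0, (0 < c)%R /\ forall n, (n0 <= n)%N ->
    (c * ((2 ^ n) ^ d)%N%:R <= pattern_count_on (@code_normal R d p) (@code_offset R d p)
      (code_tolerance R p) (code_radius p) X (2 ^ n)%N w)%R}.
  apply: ae_foralln => n; case: (choice.unpickle n) => [p|]; last first.
    by apply: aeW.
  have [adm|nadm] := pselect (admissible (@code_normal R d p) (@code_offset R d p)
    (code_tolerance R p) (code_radius p)); last first.
    by apply: aeW => w p' [<-].
  apply: filterS (pattern_density adm d0 hX hphi hsupp) => w hw p' [<-] _.
  exact: hw.
apply: filterS H => w hw Q sQ.
have [p [u [tau [x0 [eQ [M [-> adm stab ab [eeQ dMr]]]]]]]] := exists_pattern_code d0 sQ.
have [c [n0 [c0 hc]]] := hw (choice.pickle p) p (choice.pickleK p) adm.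
have [_ r0 _ _ _] := adm; have [[XH _ _] _ _ _ _] := hX.
apply: (pattern_counts_positive_density d0 stab ab eeQ r0 dMr (XH w) c0) => n /hc.
move=> h; apply: le_trans h _; rewrite /pattern_count_on /occurrences.
rewrite -sum1_card natr_sum [leRHS]big_mkcond/=; apply: ler_sum => k _.
rewrite indicE inE; case: asboolP => [_|npat]; first by case: (_ \in _).
by rewrite memNset.
Qed.
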